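(* Let $M$ be a $G$-graded $R$-module and suppose that $\rho$ is surjective. Then the following statements are equivalent: (1) $\mathcal{PS}_G(M)$ is a $T_0$-space. (2) Whenever $\nu_G(Q)=\nu_G(Q')$ with $Q,Q'\in\mathcal{PS}_G(M)$, then $Q=Q'$. (3) $\rho$ is injective. (4) $|\mathcal{PS}_G^p(M)|\leq 1$ for every $p\in Spec_G(R)$. (5) $\mathcal{PS}_G(M)$ is a spectral space.
   Context: $G$ is a multiplicative group, $R=\bigoplus_{g\in G}R_g$ is a commutative $G$-graded ring with identity ($R_gR_h\subseteq R_{gh}$), and $M=\bigoplus_{g\in G}M_g$ is a $G$-graded $R$-module ($R_gM_h\subseteq M_{gh}$). $h(R)=\bigcup_g R_g$ and $h(M)=\bigcup_g M_g$ are the sets of homogeneous elements. An ideal $I$ is graded if $I=\bigoplus_g(I\cap R_g)$; a submodule $N$ is graded if $N=\bigoplus_g(N\cap M_g)$. For a graded submodule $N$, $(N:_R M)=\{r\in R: rM\subseteq N\}$, a graded ideal of $R$. For a graded ideal $I$, the graded radical $Gr(I)$ is the set of all $a=\sum_g a_g\in R$ such that for each $g$ there is $n_g>0$ with $a_g^{n_g}\in I$. For a graded ring $A$, a graded prime ideal is a proper graded ideal $p$ such that $ab\in p$ with $a,b\in h(A)$ implies $a\in p$ or $b\in p$; $Spec_G(A)$ is the set of these. A proper graded submodule $P$ of $M$ is graded prime if for $r\in h(R)$, $m\in h(M)$, $rm\in P$ implies $m\in P$ or $r\in(P:_R M)$. $Spec_G(M)$ is the set of graded prime submodules of $M$. A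 proper graded submodule $Q$ is graded primary if for $r\in h(R)$, $m\in h(M)$, $rm\in Q$ implies $m\in Q$ or $r\in Gr((Q:_R M))$. For a graded submodule $N$, $Gr_M(N)$ is the intersection of all graded prime submodules of $M$ containing $N$, with $Gr_M(N)=M$ if there are none. The graded primary spectrum $\mathcal{PS}_G(M)$ is the set of all graded primary submodules $Q$ of $M$ with $(Gr_M(Q):_R M)=Gr((Q:_R M))$; for such $Q$, $(Gr_M(Q):_R M)\in Spec_G(R)$. For a graded submodule $N$ of $M$, $\nu_G(N)=\{Q\in\mathcal{PS}_G(M): (N:_R M)\subseteq(Gr_M(Q):_R M)\}$. $\mathcal{PS}_G(M)$ carries the Zariski topology, whose closed sets are exactly the sets $\nu_G(N)$, $N$ a graded submodule of $M$. For $p\in Spec_G(R)$, $\mathcal{PS}_G^p(M)=\{Q\in\mathcal{PS}_G(M): (Gr_M(Q):_R M)=p\}$. Write $\overline{R}=R/Ann(M)$ with the induced grading. The map $\rho:\mathcal{PS}_G(M)\to Spec_G(\overline{R})$ is $\rho(Q)=(Gr_M(Q):_R M)/Ann(M)$. A space is $T_0$ if distinct points have distinct closures. A space is spectral if it is homeomorphic to the prime spectrum of a (commutative) ring with the Zariski topology; by Hochster this is equivalent to: $T_0$, quasi-compact, the quasi-compact open subsets are closed under finite intersection and form an open base, and each irreducible closed subset has a generic point. Standing assumption: $Spec_G(M)$ and $\mathcal{PS}_G(M)$ are non-empty. *)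

(* Defs.v *)
From HB Require Import structures.
From mathcomp Require Import all_boot all_algebra finmap.
From mathcomp Require Import all_classical topology.

Set Implicit Arguments.
Unset Strict Implicit.
Unset Printing Implicit Defensive.

Import GRing.Theory.
Local Open Scope classical_set_scope.
Local Open Scope ring_scope.
Local Open Scope quotient_scope.

Definition additive_subgroup (V : zmodType) (H : set V) : Prop :=
  H 0 /\ forall x y, H x -> H y -> H (x - y).

Definition decomposes (I : choiceType) (V : zmodType) (Vg : I -> set V)
    (x : V) (f : I -> V) : Prop :=
  [/\ forall g, Vg g (f g),
      finite_set [set g | f g != 0] &
      x = \sum_(g \in [set: I]) f g].

Definition direct_sum (I : choiceType) (V : zmodType) (N : set V)
    (Vg : I -> set V) : Prop :=
  (forall x, N x <-> exists f, decomposes Vg x f) /\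
  (forall x f f', decomposes Vg x f -> decomposes Vg x f' -> f = f').

Record ring_grading (G : groupType) (R : comPzRingType) := RingGrading {
  rpart :> G -> set R;
  rpart_subgroup : forall g, additive_subgroup (rpart g);
  rpart_direct_sum : direct_sum [set: R] rpart;
  rpart_mul : forall g h a b,
    rpart g a -> rpart h b -> rpart (g * h)%g (a * b)
}.

Record module_grading (G : groupType) (R : comPzRingType)
    (RG : ring_grading G R) (M : lmodType R) := ModuleGrading {
  mpart :> G -> set M;
  mpart_subgroup : forall g, additive_subgroup (mpart g);
  mpart_direct_sum : direct_sum [set: M] mpart;
  mpart_scale : forall g h a m,
    RG g a -> mpart h m -> mpart (g * h)%g (a *: m)
}.

Definition homogeneous (I V : Type) (Vg : I -> set V) : set V :=
  [set x | exists g, Vg g x].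

Definition ideal (R : comPzRingType) (I : set R) : Prop :=
  [/\ I 0, forall a b, I a -> I b -> I (a + b) &
      forall r a, I a -> I (r * a)].

Definition submodule (R : comPzRingType) (M : lmodType R) (N : set M) : Prop :=
  [/\ N 0, forall x y, N x -> N y -> N (x + y) &
      forall (r : R) x, N x -> N (r *: x)].

Definition graded_ideal (G : groupType) (R : comPzRingType)
    (RG : ring_grading G R) (I : set R) : Prop :=
  ideal I /\ direct_sum I (fun g => I `&` RG g).

Definition graded_submodule (G : groupType) (R : comPzRingType)
    (RG : ring_grading G R) (M : lmodType R) (MG : module_grading RG M)
    (N : set M) : Prop :=
  submodule N /\ direct_sum N (fun g => N `&` MG g).

(* [colon N] is $(N :_R M)$. *)
Definition colon (R : comPzRingType) (M : lmodType R) (N : set M) : set R :=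
  [set r | forall m, N (r *: m)].

(* By [rpart_direct_sum], [f] is the unique family of homogeneous components
   of [a]. *)
Definition graded_radical (G : groupType) (R : comPzRingType)
    (RG : ring_grading G R) (I : set R) : set R :=
  [set a | exists2 f, decomposes RG a f &
           forall g, exists2 n, (0 < n)%N & I (f g ^+ n)].

Definition graded_prime_ideal (G : groupType) (R : comPzRingType)
    (RG : ring_grading G R) (p : set R) : Prop :=
  [/\ graded_ideal RG p, p <> [set: R] &
      forall a b, homogeneous RG a -> homogeneous RG b ->
        p (a * b) -> p a \/ p b].

Record Spec_G (G : groupType) (R : comPzRingType) (RG : ring_grading G R) :=
  SpecG {
    SpecG_set :> set R;
    SpecG_prime : graded_prime_ideal RG SpecG_set
  }.

Section GradedSubmodules.
Context (G : groupType) (R : comPzRingType) (RG : ring_grading G R).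
Context (M : lmodType R) (MG : module_grading RG M).

Definition graded_prime_submodule (P : set M) : Prop :=
  [/\ graded_submodule MG P, P <> [set: M] &
      forall r m, homogeneous RG r -> homogeneous MG m ->
        P (r *: m) -> P m \/ colon P r].

Definition graded_primary_submodule (Q : set M) : Prop :=
  [/\ graded_submodule MG Q, Q <> [set: M] &
      forall r m, homogeneous RG r -> homogeneous MG m ->
        Q (r *: m) -> Q m \/ graded_radical RG (colon Q) r].

(* The intersection of the empty family is [setT], that is, all of $M$. *)
Definition Gr_M (N : set M) : set M :=
  \bigcap_(P in [set P | graded_prime_submodule P /\ N `<=` P]) P.

Record PS_G := PSG {
  PSG_set :> set M;
  PSG_primary : graded_primary_submodule PSG_set;
  PSG_radical : colon (Gr_M PSG_set) = graded_radical RG (colon PSG_set)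
}.

Definition nu_G (N : set M) : set PS_G :=
  [set Q : PS_G | colon N `<=` colon (Gr_M Q)].

Definition PS_Gp (p : Spec_G RG) : set PS_G :=
  [set Q : PS_G | colon (Gr_M Q) = p].

End GradedSubmodules.

Arguments nu_G {G R RG M} MG N _.
Arguments PS_Gp {G R RG M} MG p _.

Section Decompositions.
Context (I : choiceType) (V : zmodType).
Implicit Types (Vg : I -> set V) (f : I -> V).

Lemma decomposesP Vg x f : decomposes Vg x f <->
  (forall g, Vg g (f g)) /\
  exists s : seq I, [/\ uniq s, forall g, g \notin s -> f g = 0 &
                        x = \sum_(g <- s) f g].
Proof.
split=> [[Vf fin ->]|[Vf [s [us sf ->]]]].
  split=> //; case/finite_fsetP: fin => X eX; exists (enum_fset X).
  have X0 g : g \notin enum_fset X -> f g = 0.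
    move=> gX; apply/eqP/negPn/negP => fg.
    suff : [set` X] g by move=> /= gX'; rewrite gX' in gX.
    by rewrite -eX.
  split=> //; rewrite (fsbigE (enum_fset X)) ?(fset_uniq X) //; first by apply: eq_bigl => i; rewrite in_setT.
  by move=> g _; apply: X0.
split=> //.
  apply: (@sub_finite_set _ _ [set` s]); last exact: finite_seq.
  by move=> g /= fg; apply: contraNT fg => /sf ->.
rewrite (fsbigE s) //; first by apply: eq_bigl => i; rewrite in_setT.
by move=> g _; apply: sf.
Qed.

Lemma decomposes_sub Vg Vg' x f : (forall g, Vg g `<=` Vg' g) ->
  decomposes Vg x f -> decomposes Vg' x f.
Proof. by move=> s [h1 h2 h3]; split=> // g; apply: s. Qed.

Lemma decomposes1 Vg g x : (forall h, Vg h 0) -> Vg g x ->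
  decomposes Vg x (fun h => if h == g then x else 0).
Proof.
move=> V0 Vx; apply/decomposesP; split=> [h|]; first by case: eqP => // ->.
exists [:: g]; split=> //; last by rewrite big_seq1 eqxx.
by move=> h; rewrite inE => /negPf ->.
Qed.

Lemma decomposesB Vg x y f f' : (forall g, additive_subgroup (Vg g)) ->
  decomposes Vg x f -> decomposes Vg y f' ->
  decomposes Vg (x - y) (fun g => f g - f' g).
Proof.
move=> sub [Vf fin ->] [Vf' fin' ->]; split.
- by move=> g; apply: (sub g).2.
- apply: (@sub_finite_set _ _ ([set g | f g != 0] `|` [set g | f' g != 0]));
    last by rewrite finite_setU.
  move=> g /= ne; case: (eqVneq (f g) 0) => [fg0|]; last by left.
  by right; apply: contraNneq ne => f'g0; rewrite fg0 f'g0 subrr.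
- have /decomposesP [_ [s [_ sf _]]] :
    decomposes (fun=> setT) (\sum_(g \in setT) f g) f by split.
  have /decomposesP [_ [s' [_ sf' _]]] :
    decomposes (fun=> setT) (\sum_(g \in setT) f' g) f' by split.
  rewrite [RHS](fsbigE (undup (s ++ s'))) ?undup_uniq //; last first.
    move=> g _; rewrite mem_undup mem_cat negb_or => /andP[/sf -> /sf' ->].
    by rewrite subrr.
  under [RHS]eq_bigl do rewrite in_setT.
  rewrite sumrB; congr (_ - _).
    rewrite (fsbigE (undup (s ++ s'))) ?undup_uniq //.
      by apply: eq_bigl => i; rewrite in_setT.
    by move=> g _; rewrite mem_undup mem_cat negb_or => /andP[/sf -> _].
  rewrite (fsbigE (undup (s ++ s'))) ?undup_uniq //.
    by apply: eq_bigl => i; rewrite in_setT.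
  by move=> g _; rewrite mem_undup mem_cat negb_or => /andP[_ /sf' ->].
Qed.

Lemma decomposes_in Vg (N : set V) x f : N 0 ->
  (forall y z, N y -> N z -> N (y + z)) ->
  decomposes Vg x f -> (forall g, N (f g)) -> N x.
Proof.
move=> N0 ND /decomposesP [_ [s [_ _ ->]]] Nf.
by elim/big_rec: _ => // g y _; apply: ND.
Qed.

Lemma graded_direct_sumP Vg (N : set V) : N 0 ->
  (forall y z, N y -> N z -> N (y + z)) -> direct_sum [set: V] Vg ->
  direct_sum N (fun g => N `&` Vg g) <->
  forall x f, N x -> decomposes Vg x f -> forall g, N (f g).
Proof.
move=> N0 ND [ex un]; split=> [[exN _] x f /exN [f' df'] df g|H].
  have [Nf' _ _] := df'.
  rewrite (un x f f') //; first by case: (Nf' g).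
  by apply: decomposes_sub df' => h y [].
split=> [x|x f f' df df']; last first.
  by apply: (un x); [apply: decomposes_sub df|apply: decomposes_sub df'] => h y [].
split=> [Nx|[f df]].
  have [f df] := (ex x).1 Logic.I; exists f; have [df1 df2 df3] := df.
  by split=> // g; split; [apply: (H x)|].
by apply: (decomposes_in N0 ND df) => g; have [/(_ g) []] := df.
Qed.

End Decompositions.

Lemma decomposes_lin (I I' : choiceType) (V W : zmodType) (Vg : I -> set V)
    (Wg : I' -> set W) (phi : V -> W) (k : I -> I') (k' : I' -> I) x f :
  cancel k k' -> cancel k' k ->
  (forall y z, phi (y - z) = phi y - phi z) ->
  (forall g, Vg g `<=` [set y | Wg (k g) (phi y)]) ->
  decomposes Vg x f -> decomposes Wg (phi x) (fun h => phi (f (k' h))).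
Proof.
move=> kK k'K phiB VW /decomposesP [Vf [s [us sf ->]]].
have phi0 : phi 0 = 0 by rewrite -(subrr 0) phiB subrr.
have phiD y z : phi (y + z) = phi y + phi z.
  by rewrite -[z in LHS]opprK phiB -[- z]sub0r phiB phi0 sub0r opprK.
apply/decomposesP; split.
  by move=> h; have := VW _ _ (Vf (k' h)); rewrite /= k'K.
exists (map k s); split.
- by rewrite map_inj_uniq //; apply: can_inj kK.
- move=> h hs; rewrite sf // ; apply: contra hs => /(map_f k).
  by rewrite k'K.
- rewrite big_map (big_morph phi phiD phi0).
  by apply: eq_bigr => g _; rewrite kK.
Qed.

Section RingFacts.
Context (G : groupType) (R : comPzRingType) (RG : ring_grading G R).
Implicit Types (I p : set R) (a b : R).

Lemma rpart0 g : RG g 0. Proof. by have [] := rpart_subgroup RG g. Qed.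

Lemma ring_decomp a : exists f, decomposes RG a f.
Proof. exact: ((rpart_direct_sum RG).1 a).1 Logic.I. Qed.

Lemma ring_decomp_uniq a f f' :
  decomposes RG a f -> decomposes RG a f' -> f = f'.
Proof. exact: (rpart_direct_sum RG).2. Qed.

Lemma graded_idealP I : ideal I -> graded_ideal RG I <->
  forall a f, I a -> decomposes RG a f -> forall g, I (f g).
Proof.
move=> idI; have [I0 ID _] := idI.
have P := graded_direct_sumP I0 ID (rpart_direct_sum RG).
by split=> [[_ /P]|/P].
Qed.

Lemma rpart1 : RG 1%g 1.
Proof.
have [u du] := ring_decomp 1; have [u1 _ _] := du.
suff H a : u 1%g * a = a by rewrite -[X in RG _ X](H 1) mulr1.
have hom h b : RG h b -> u 1%g * b = b.
  move=> hb.
  have := @decomposes_lin _ _ _ _ RG RG (fun r => r * b)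
    (fun g => g * h)%g (fun g => g * h^-1)%g 1 u (mulgK h) (mulgVK h)
    (fun y z => mulrBl b y z) (fun g y yg => rpart_mul yg hb) du.
  rewrite mul1r => /ring_decomp_uniq /(_ (decomposes1 rpart0 hb)).
  by move=> /(congr1 (fun f => f h)) /=; rewrite eqxx mulgV.
have [f df] := ring_decomp a.
apply: (decomposes_in (N := [set b | u 1%g * b = b]) _ _ df) => /=.
- by rewrite mulr0.
- by move=> y z e e'; rewrite mulrDr e e'.
- by move=> g; have [+ _ _] := df => /(_ g); apply: hom.
Qed.

Lemma rpartX g a n : RG g a -> homogeneous RG (a ^+ n).
Proof.
move=> ga; elim: n => [|n [h ih]]; first by exists 1%g; apply: rpart1.
by exists (g * h)%g; rewrite exprS; apply: rpart_mul.
Qed.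

Lemma graded_radical_hom I g a : I 0 -> RG g a ->
  graded_radical RG I a <-> exists2 n, (0 < n)%N & I (a ^+ n).
Proof.
move=> I0 ga; have d1 := decomposes1 rpart0 ga.
split=> [[f df H]|[n n0 Ian]].
  by have := H g; rewrite (ring_decomp_uniq df d1) eqxx.
exists (fun h => if h == g then a else 0) => // h.
by case: eqP => _; [exists n | exists 1%N; rewrite ?expr1].
Qed.

Lemma homogeneous_notin I J : ideal I -> graded_ideal RG J ->
  ~ (J `<=` I) -> exists a, [/\ homogeneous RG a, J a & ~ I a].
Proof.
move=> [I0 ID _] gJ nJI; apply: contrapT => H; apply: nJI => a Ja.
have [f df] := ring_decomp a; apply: (decomposes_in I0 ID df) => g.
apply: contrapT => nI; apply: H; exists (f g); split=> //.
  by exists g; have [/(_ g)] := df.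
by apply: ((graded_idealP gJ.1).1 gJ _ _ Ja df).
Qed.

End RingFacts.

Section ModuleFacts.
Context (G : groupType) (R : comPzRingType) (RG : ring_grading G R).
Context (M : lmodType R) (MG : module_grading RG M).
Implicit Types (N P Q : set M).

Lemma mpart0 g : MG g 0. Proof. by have [] := mpart_subgroup MG g. Qed.

Lemma module_decomp m : exists f, decomposes MG m f.
Proof. exact: ((mpart_direct_sum MG).1 m).1 Logic.I. Qed.

Lemma graded_submoduleP N : submodule N -> graded_submodule MG N <->
  forall m f, N m -> decomposes MG m f -> forall g, N (f g).
Proof.
move=> sN; have [N0 ND _] := sN.
have P := graded_direct_sumP N0 ND (mpart_direct_sum MG).
by split=> [[_ /P]|/P].
Qed.

Lemma graded_submodule0 : graded_submodule MG [set 0].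
Proof.
have s0 : submodule [set 0 : M].
  by split=> [//|x y /= -> ->|r x /= ->]; rewrite ?addr0 ?scaler0.
apply/(graded_submoduleP s0) => m f -> df g /=.
have d0 := decomposes1 mpart0 (mpart0 g).
rewrite ((mpart_direct_sum MG).2 _ _ _ df d0); by case: ifP.
Qed.

Lemma graded_submoduleT : graded_submodule MG setT.
Proof. by apply/graded_submoduleP. Qed.

Lemma graded_submodule_bigcap (F : set (set M)) :
  (forall N, F N -> graded_submodule MG N) ->
  graded_submodule MG (\bigcap_(N in F) N).
Proof.
move=> FG; apply/graded_submoduleP.
  split=> [N /FG [[] //]|x y Nx Ny N FN|r x Nx N FN]; have [[_ D Z] _] := FG _ FN.
    by apply: D; [apply: Nx|apply: Ny].
  by apply: Z; apply: Nx.
move=> m f Nm df g N FN; have gN := FG _ FN.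
exact: ((graded_submoduleP gN.1).1 gN m f (Nm _ FN) df).
Qed.

Lemma Gr_M_graded N : graded_submodule MG (Gr_M MG N).
Proof. by apply: graded_submodule_bigcap => P [[]]. Qed.

Lemma colonS N N' : N `<=` N' -> colon N `<=` colon N'.
Proof. by move=> NN' r rN m; apply: NN'. Qed.

Lemma colonI N N' : colon (N `&` N') = colon N `&` colon N'.
Proof.
apply/seteqP; split=> r; first by move=> H; split=> m; case: (H m).
by case=> H H' m; split; [apply: H|apply: H'].
Qed.

Lemma colon_ideal N : submodule N -> ideal (colon N).
Proof.
move=> [N0 ND NZ]; split=> [m|a b Na Nb m|r a Na m].
- by rewrite scale0r.
- by rewrite scalerDl; apply: ND.
- by rewrite -scalerA; apply: NZ; apply: Na.
Qed.

Lemma colon_graded N : graded_submodule MG N -> graded_ideal RG (colon N).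
Proof.
move=> gN; have [[N0 ND NZ] _] := gN.
apply/(graded_idealP _ (colon_ideal gN.1)) => r f Nr df g m.
have [m_ dm] := module_decomp m.
pose C := [set x : M | N (f g *: x)].
apply: (decomposes_in (N := C) _ _ dm) => /= [|y z|h]; rewrite /C /=.
- by rewrite scaler0.
- by rewrite scalerDr; apply: ND.
have mh : MG h (m_ h) by have [/(_ h)] := dm.
have := @decomposes_lin _ _ _ _ RG MG (fun r => r *: m_ h)
    (fun g => g * h)%g (fun g => g * h^-1)%g r f (mulgK h) (mulgVK h)
    (fun y z => scalerBl y z (m_ h)) (fun g y yg => mpart_scale yg mh) df.
move=> /((graded_submoduleP gN.1).1 gN _ _ (Nr _)) /(_ (g * h)%g).
by rewrite mulgK.
Qed.

Lemma colon1 N : colon N 1 -> N = setT.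
Proof. by move=> H; apply/seteqP; split=> // m _; rewrite -[m]scale1r. Qed.

Lemma PS_G_prime (Q : PS_G MG) : graded_prime_ideal RG (colon (Gr_M MG Q)).
Proof.
have [gQ QT pQ] := PSG_primary Q.
have gc := colon_graded gQ; have [[c0 cD cM] _] := gc.
split; first exact: (colon_graded (Gr_M_graded Q)).
  move=> e; have : colon (Gr_M MG Q) 1 by rewrite e.
  rewrite PSG_radical => /(graded_radical_hom c0 (rpart1 RG)) [n _].
  by rewrite expr1n => /colon1.
move=> a b [g ga] [h hb]; rewrite PSG_radical.
move=> /(graded_radical_hom c0 (rpart_mul ga hb)) [n n0 cab].
apply: contrapT => /not_orP [na nb]; apply: nb.
apply/(graded_radical_hom c0 hb); exists n => // m.
have [m_ dm] := module_decomp m; have [[Q0 QD _] _] := gQ.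
pose C := [set x : M | PSG_set Q (b ^+ n *: x)].
apply: (decomposes_in (N := C) _ _ dm); rewrite /C /=.
- by rewrite scaler0.
- by move=> y z; rewrite scalerDr; apply: QD.
move=> k; have mk : MG k (m_ k) by have [/(_ k)] := dm.
have [h' hb'] := rpartX n hb.
have hbm : homogeneous MG (b ^+ n *: m_ k).
  by exists (h' * k)%g; apply: mpart_scale.
have := cab (m_ k); rewrite exprMn -scalerA.
case/(pQ _ _ (rpartX n ga) hbm) => //.
have [g' ga'] := rpartX n ga.
move=> /(graded_radical_hom c0 ga') [n' n'0 can]; exfalso; apply: na.
apply/(graded_radical_hom c0 ga); exists (n * n')%N; rewrite ?muln_gt0 ?n0 //.
by rewrite exprM.
Qed.

End ModuleFacts.

Section ZariskiPS.
Context (G : groupType) (R : comPzRingType) (RG : ring_grading G R).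
Context (M : lmodType R) (MG : module_grading RG M).

HB.instance Definition _ := gen_eqMixin (PS_G MG).
HB.instance Definition _ := gen_choiceMixin (PS_G MG).

Definition PS_G_open (U : set (PS_G MG)) : Prop :=
  exists2 N, graded_submodule MG N & ~` U = nu_G MG N.

Lemma PS_G_openT : PS_G_open setT.
Proof.
exists setT; first exact: graded_submoduleT.
rewrite setCT; apply/seteqP; split=> // Q H.
have [_ pT _] := PS_G_prime Q; apply: pT.
by apply/seteqP; split=> // r _; apply: H.
Qed.

Lemma PS_G_openI : setI_closed PS_G_open.
Proof.
move=> U U' [N gN eU] [N' gN' eU']; exists (N `&` N').
  have -> : N `&` N' = \bigcap_(P in [set N; N']) P.
    by rewrite bigcap_setU !bigcap_set1.
  by apply: graded_submodule_bigcap => P [] ->.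
rewrite setCI eU eU'; apply/seteqP; split=> Q.
  by case=> H r; rewrite colonI => -[]; [move=> /H|move=> _ /H].
rewrite /nu_G /= colonI => H; apply: contrapT => /not_orP [n n'].
have [gp _ pp] := PS_G_prime Q.
have [a [ha Na pa]] := homogeneous_notin gp.1 (colon_graded gN) n.
have [b [hb Nb pb]] := homogeneous_notin gp.1 (colon_graded gN') n'.
have [[_ _ cM] _] := colon_graded gN; have [[_ _ cM'] _] := colon_graded gN'.
have : colon (Gr_M MG Q) (a * b).
  by apply: H; split; [rewrite mulrC; apply: cM|apply: cM'].
by case/(pp _ _ ha hb).
Qed.

Lemma PS_G_open_bigU (I : Type) (f : I -> set (PS_G MG)) :
  (forall i, PS_G_open (f i)) -> PS_G_open (\bigcup_i f i).
Proof.
move=> fo; have [N gN eN] := all_sig2 (fun i => cid2 (fo i)).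
pose F := [set N' | graded_submodule MG N' /\
  forall i r m, colon (N i) r -> N' (r *: m)].
exists (\bigcap_(N' in F) N').
  by apply: graded_submodule_bigcap => N' [].
rewrite setC_bigcup; apply/seteqP; split=> Q H.
  apply: colonS => x; apply; split; first exact: Gr_M_graded.
  move=> i r m Nr; have : (~` f i) Q by apply: H.
  by rewrite eN => /(_ _ Nr).
move=> i _; rewrite eN => r Nr; apply: H => m N' [_]; exact.
Qed.

HB.instance Definition _ := isOpenTopological.Build (PS_G MG)
  PS_G_openT PS_G_openI PS_G_open_bigU.

Lemma closed_PS_G (S : set (PS_G MG)) :
  closed S <-> exists2 N, graded_submodule MG N & S = nu_G MG N.
Proof. by rewrite -openC -[open (~` S)]/(PS_G_open _) /PS_G_open setCK. Qed.

End ZariskiPS.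

Definition Ann (R : comPzRingType) (M : lmodType R) : set R :=
  colon [set 0 : M].

Definition annihilator (R : comPzRingType) (M : lmodType R) : {pred R} :=
  fun r => `[< Ann M r >].

Lemma annihilator_zmod_closed (R : comPzRingType) (M : lmodType R) :
  zmod_closed (annihilator M).
Proof.
split=> [|x y]; rewrite !unfold_in; first by apply/asboolP => m; rewrite scale0r.
move=> /asboolP xM /asboolP yM; apply/asboolP => m.
by rewrite scalerBl (xM m) (yM m) subrr.
Qed.

HB.instance Definition _ (R : comPzRingType) (M : lmodType R) :=
  GRing.isZmodClosed.Build R (annihilator M) (annihilator_zmod_closed M).

(* [{quot _}] only carries a ring structure for proper ideals of nonzero rings,
   so the multiplication on the additive quotient is added here. *)
Definition Rbar (R : comPzRingType) (M : lmodType R) :=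
  Quotient.quot (annihilator M).

HB.instance Definition _ (R : comPzRingType) (M : lmodType R) :=
  GRing.Zmodule.on (Rbar M).

Section Rbar.
Context (R : comPzRingType) (M : lmodType R).

Definition toRbar (r : R) : Rbar M := \pi_(Quotient.quot (annihilator M)) r.

Definition fromRbar (x : Rbar M) : R :=
  repr (x : Quotient.quot (annihilator M)).

Lemma fromRbarK : cancel fromRbar toRbar.
Proof. by move=> x; apply: reprK. Qed.

Lemma toRbarB : {morph toRbar : x y / x - y}.
Proof. by move=> x y; rewrite /toRbar !piE. Qed.

Lemma toRbar_eq x y : toRbar x = toRbar y <-> Ann M (x - y).
Proof.
have := Quotient.idealrBE (annihilator M) x y; rewrite unfold_in => e.
by split=> [/eqP H|H]; [apply/asboolP; rewrite e|apply/eqP; rewrite -e; apply/asboolP].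
Qed.

Definition Rbar_one : Rbar M := toRbar 1.
Definition Rbar_mul (x y : Rbar M) : Rbar M :=
  toRbar (fromRbar x * fromRbar y).

Lemma toRbarM : {morph toRbar : x y / x * y >-> Rbar_mul x y}.
Proof.
move=> x y; apply/toRbar_eq.
have /toRbar_eq hx : toRbar x = toRbar (fromRbar (toRbar x)) by rewrite fromRbarK.
have /toRbar_eq hy : toRbar y = toRbar (fromRbar (toRbar y)) by rewrite fromRbarK.
move: hx hy; set x' := fromRbar _; set y' := fromRbar _ => hx hy m.
have -> : x * y - x' * y' = y * (x - x') + x' * (y - y').
  by rewrite !mulrBr (mulrC y) (mulrC y x') addrA subrK.
by rewrite /= scalerDl -!scalerA (hx m) (hy m) !scaler0 addr0.
Qed.

Lemma Rbar_mulA : associative Rbar_mul.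
Proof.
by move=> x y z; rewrite -[x]fromRbarK -[y]fromRbarK -[z]fromRbarK -!toRbarM mulrA.
Qed.

Lemma Rbar_mulC : commutative Rbar_mul.
Proof. by move=> x y; rewrite /Rbar_mul mulrC. Qed.

Lemma Rbar_mul1 : left_id Rbar_one Rbar_mul.
Proof. by move=> x; rewrite -[x]fromRbarK -toRbarM mul1r. Qed.

Lemma toRbarD : {morph toRbar : x y / x + y}.
Proof. by move=> x y; rewrite /toRbar !piE. Qed.

Lemma Rbar_mulD : left_distributive Rbar_mul +%R.
Proof.
move=> x y z; rewrite -[x]fromRbarK -[y]fromRbarK -[z]fromRbarK.
by rewrite -toRbarD -!toRbarM mulrDl toRbarD.
Qed.

HB.instance Definition _ := GRing.Zmodule_isComPzRing.Build (Rbar M)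
  Rbar_mulA Rbar_mulC Rbar_mul1 Rbar_mulD.

End Rbar.

Section RbarGrading.
Context (G : groupType) (R : comPzRingType) (RG : ring_grading G R).
Context (M : lmodType R) (MG : module_grading RG M).

Definition Rbar_part (g : G) : set (Rbar M) := toRbar M @` RG g.

Lemma toRbar0 : toRbar M 0 = 0.
Proof. by rewrite -(subrr 0) toRbarB subrr. Qed.

Lemma Ann_graded : graded_ideal RG (Ann M).
Proof. exact: colon_graded (graded_submodule0 MG). Qed.

Lemma Rbar_part_subgroup g : additive_subgroup (Rbar_part g).
Proof.
have [R0 RB] := rpart_subgroup RG g; split; first by exists 0; rewrite ?toRbar0.
move=> _ _ [x gx <-] [y gy <-]; exists (x - y); first exact: RB.
exact: toRbarB.
Qed.

Lemma toRbar_decomp a f : decomposes RG a f ->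
  decomposes Rbar_part (toRbar M a) (fun g => toRbar M (f g)).
Proof.
apply: (@decomposes_lin _ _ _ _ RG Rbar_part (toRbar M) id id) => //.
  exact: toRbarB.
by move=> g x gx; exists x.
Qed.

Lemma Rbar_decomp_lift x f : decomposes Rbar_part x f ->
  exists a f', [/\ x = toRbar M a, decomposes RG a f' &
                   forall g, f g = toRbar M (f' g)].
Proof.
move=> /decomposesP [fR [s [us sf ->]]].
have /choice [f' f'P] g : exists b, [/\ RG g b, toRbar M b = f g &
    g \notin s -> b = 0].
  have [gs|gs] := boolP (g \in s).
    by have [b gb e] := fR g; exists b.
  by exists 0; split=> //; [apply: rpart0|rewrite toRbar0 sf].
exists (\sum_(g <- s) f' g), f'; split.
- rewrite (big_morph _ (@toRbarD _ M) toRbar0).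
  by apply: eq_bigr => g _; have [] := f'P g.
- apply/decomposesP; split=> [g|]; first by have [] := f'P g.
  by exists s; split=> // g; have [] := f'P g.
- by move=> g; have [] := f'P g.
Qed.

Lemma Rbar_direct_sum : direct_sum [set: Rbar M] Rbar_part.
Proof.
split=> [x|x f f' /Rbar_decomp_lift [a [h [ea dh fh]]]
                 /Rbar_decomp_lift [a' [h' [ea' dh' fh']]]].
  split=> // _; have [f df] := ring_decomp RG (fromRbar x).
  exists (fun g => toRbar M (f g)); rewrite -[x]fromRbarK.
  exact: toRbar_decomp.
apply/funext => g; rewrite fh fh'; apply/toRbar_eq.
have Aaa' : Ann M (a - a') by apply/toRbar_eq; rewrite -ea.
have dB := decomposesB (rpart_subgroup RG) dh dh'.
exact: ((graded_idealP _ Ann_graded.1).1 Ann_graded _ _ Aaa' dB g).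
Qed.

Lemma Rbar_part_mul g h x y :
  Rbar_part g x -> Rbar_part h y -> Rbar_part (g * h)%g (x * y).
Proof.
move=> [a ga <-] [b hb <-]; exists (a * b); first exact: rpart_mul.
exact: toRbarM.
Qed.

Definition Rbar_grading : ring_grading G (Rbar M) :=
  RingGrading Rbar_part_subgroup Rbar_direct_sum Rbar_part_mul.

Lemma Rbar_image_prime (p : set R) : Ann M `<=` p ->
  graded_prime_ideal RG p ->
  graded_prime_ideal Rbar_grading (toRbar M @` p).
Proof.
move=> Ap [gp pT pp]; have [idp _] := gp; have [p0 pD pM] := idp.
have pE a : (toRbar M @` p) (toRbar M a) <-> p a.
  split=> [[b pb /toRbar_eq /Ap]|pa]; last by exists a.
  move=> /(pM (-1)); rewrite mulN1r opprB => /pD /(_ pb).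
  by rewrite subrK.
have ip : ideal (toRbar M @` p).
  split; first by rewrite -toRbar0; apply/pE.
    by move=> _ _ [a pa <-] [b pb <-]; rewrite -toRbarD; apply/pE/pD.
  move=> r _ [a pa <-]; rewrite -[r]fromRbarK -[_ * _]toRbarM.
  by apply/pE/pM.
split.
- apply/(graded_idealP _ ip) => x f px /Rbar_decomp_lift [a [h [ea dh fh]]] g.
  move: px; rewrite ea fh => /pE pa; apply/pE.
  exact: ((graded_idealP _ idp).1 gp _ _ pa dh).
- move=> e; apply: pT; apply/seteqP; split=> // a _; apply/pE.
  by rewrite e.
- move=> _ _ [g [a ga <-]] [h [b hb <-]]; rewrite -[_ * _]toRbarM => /pE.
  by case/pp; [exists g|exists h|left; apply/pE|right; apply/pE].
Qed.

Lemma rho_prime (Q : PS_G MG) :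
  graded_prime_ideal Rbar_grading (toRbar M @` colon (Gr_M MG Q)).
Proof.
apply: Rbar_image_prime; last exact: PS_G_prime.
apply: colonS => _ ->.
by have [[N0 _ _] _] := Gr_M_graded MG Q.
Qed.

Definition rho (Q : PS_G MG) : Spec_G Rbar_grading := SpecG (rho_prime Q).

End RbarGrading.

Arguments rho {G R RG M} MG Q.

Definition prime_ideal (A : comPzRingType) (p : set A) : Prop :=
  [/\ ideal p, p <> [set: A] & forall a b, p (a * b) -> p a \/ p b].

Record Spec (A : comPzRingType) := SpecPoint {
  Spec_set :> set A;
  Spec_prime : prime_ideal Spec_set
}.

Definition zeros (A : comPzRingType) (E : set A) : set (Spec A) :=
  [set p : Spec A | E `<=` p].

Section ZariskiSpec.
Context (A : comPzRingType).

HB.instance Definition _ := gen_eqMixin (Spec A).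
HB.instance Definition _ := gen_choiceMixin (Spec A).

Definition Spec_open (U : set (Spec A)) : Prop :=
  exists2 I, ideal I & ~` U = zeros I.

Lemma Spec_openT : Spec_open setT.
Proof.
exists setT => //; rewrite setCT; apply/seteqP; split=> // p H.
by have [_ pT _] := Spec_prime p; apply: pT; apply/seteqP; split.
Qed.

Lemma Spec_openI : setI_closed Spec_open.
Proof.
move=> U U' [I [I0 ID IM] eU] [J [J0 JD JM] eU']; exists (I `&` J).
  split=> //; first by move=> a b [? ?] [? ?]; split; [apply: ID|apply: JD].
  by move=> r a [? ?]; split; [apply: IM|apply: JM].
rewrite setCI eU eU'; apply/seteqP; split=> p.
  by case=> H x [Ix Jx]; apply: H.
move=> H; apply: contrapT => /not_orP [/existsNP [a /not_implyP [Ia pa]]].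
move=> /existsNP [b /not_implyP [Jb pb]].
have [_ _ pp] := Spec_prime p.
have : Spec_set p (a * b) by apply: H; split; [rewrite mulrC; apply: IM|apply: JM].
by case/pp.
Qed.

Lemma Spec_open_bigU (T : Type) (f : T -> set (Spec A)) :
  (forall i, Spec_open (f i)) -> Spec_open (\bigcup_i f i).
Proof.
move=> fo; have [I idI eI] := all_sig2 (fun i => cid2 (fo i)).
pose F := [set J | ideal J /\ forall i, I i `<=` J].
exists (\bigcap_(J in F) J).
  split=> [J [[//]]|a b Ia Ib J FJ|r a Ia J FJ]; have [[_ D Z] _] := FJ.
    by apply: D; [apply: Ia|apply: Ib].
  by apply: Z; apply: Ia.
rewrite setC_bigcup; apply/seteqP; split=> p H.
  move=> x; apply; split; first by have [] := Spec_prime p.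
  move=> i; have : (~` f i) p by apply: H.
  by rewrite eI.
by move=> i _; rewrite eI => x Ix; apply: H => J [_ /(_ i x Ix)].
Qed.

HB.instance Definition _ := isOpenTopological.Build (Spec A)
  Spec_openT Spec_openI Spec_open_bigU.

End ZariskiSpec.

Definition homeomorphic (X Y : topologicalType) : Prop :=
  exists (f : X -> Y) (g : Y -> X),
    [/\ cancel f g, cancel g f, continuous f & continuous g].

Definition spectral_space (X : topologicalType) : Prop :=
  exists A : comPzRingType, homeomorphic X (Spec A).

Definition T0_space (X : topologicalType) : Prop :=
  forall x y : X, x <> y -> closure [set x] <> closure [set y].

(* Main.v *)
Require Import Defs.
From HB Require Import structures.
From mathcomp Require Import all_boot all_algebra.
From mathcomp Require Import all_classical topology.
From mathcomp Require Import zify ring.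

(* Writing p(Q) for (Gr_M(Q) : M), both closure {Q} and nu_G(Q) consist of the Q'
   with p(Q) contained in p(Q'), and rho(Q) is p(Q)/Ann(M); hence conditions
   (1)-(4) all say that Q is determined by p(Q). Prime spectra are T_0, so (5)
   implies (1).

   For the converse we prove a form of Hochster's theorem. Let X have a base of
   open sets D_i which separates points and such that every ultrafilter U on X
   has a point y with D_i in U iff y in D_i. Let K = Q(T_i : i in I) and, for a
   point x, let v_x be the order of vanishing along the T_i with x outside D_i.
   Let A be the ring of the functions f : X -> K which depend only on membership
   in finitely many D_i, with f(x) in a subfield on which v_x is trivial
   and v_x(f(y) - f(x)) > 0 whenever x is in the closure of y. Such an f takes
   finitely many values, so v_x(f(y)) is bounded wherever f(y) <> 0. Therefore,
   if b vanishes wherever a does, then c = b^n/a is in A for large n, and b^n is a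
   multiple of a. As f + n g and {f, g} have the same zeros for some natural n,
   it follows by compactness that every prime of A consists of the f vanishing
   at a point of X.

   On PS_G(M) the sets D_a = {Q : a not in p(Q)} satisfy the hypotheses: an
   ultrafilter U defines the graded prime {a : {Q : a in p(Q)} in U}, which is
   p(Q) for some Q because rho is surjective. *)

Set Implicit Arguments.
Unset Strict Implicit.
Unset Printing Implicit Defensive.

Import GRing.Theory Num.Theory.
Local Open Scope classical_set_scope.
Local Open Scope ring_scope.

(** * The field of rational functions and its vanishing orders *)

Section PolynomialFunctions.
Context (I : Type).

(* [I] may be infinite; polynomials in the indeterminates [I] are encoded by the
   functions they define on [I -> rat]. *)
Inductive polynomial_function : ((I -> rat) -> rat) -> Prop :=
| polynomial_cst c : polynomial_function (fun=> c)
| polynomial_coord i : polynomial_function (fun u => u i)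
| polynomial_sub F G : polynomial_function F -> polynomial_function G ->
    polynomial_function (fun u => F u - G u)
| polynomial_mul F G : polynomial_function F -> polynomial_function G ->
    polynomial_function (fun u => F u * G u).

Definition polyfun_pred : {pred ((I -> rat) -> rat)} :=
  fun F => `[< polynomial_function F >].

Record polyfun := Polyfun {
  polyfun_val : (I -> rat) -> rat;
  polyfun_valP : polyfun_val \in polyfun_pred
}.

HB.instance Definition _ := [isSub for polyfun_val].
HB.instance Definition _ := [Choice of polyfun by <:].

Lemma polyfun_subring_closed : subring_closed polyfun_pred.
Proof.
split=> [|F G|F G]; rewrite !unfold_in.
- by apply/asboolP; apply: polynomial_cst.
- by move=> /asboolP f /asboolP g; apply/asboolP; apply: polynomial_sub.
- by move=> /asboolP f /asboolP g; apply/asboolP; apply: polynomial_mul.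
Qed.

HB.instance Definition _ :=
  GRing.SubChoice_isSubComPzRing.Build _ _ polyfun polyfun_subring_closed.

Definition ev (u : I -> rat) (F : polyfun) : rat := polyfun_val F u.

Lemma polyfunP (F G : polyfun) : (forall u, ev u F = ev u G) -> F = G.
Proof. by move=> FG; apply: val_inj; apply/funext. Qed.

Lemma evB u : {morph ev u : F G / F - G}.
Proof. by []. Qed.

Lemma evM u : {morph ev u : F G / F * G}.
Proof. by []. Qed.

Lemma ev1 u : ev u 1 = 1.
Proof. by []. Qed.

Lemma ev0 u : ev u 0 = 0.
Proof. by rewrite -(subrr 0) evB subrr. Qed.

Lemma polyfun_nonzero : (1 : polyfun) != 0.
Proof.
apply/eqP => /(congr1 (ev (fun=> 0))); rewrite ev1 ev0 => /eqP.
by rewrite oner_eq0.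
Qed.

HB.instance Definition _ :=
  GRing.PzSemiRing_isNonZero.Build polyfun polyfun_nonzero.

(** The fraction field is built over an integral domain, a structure that includes an inversion.
    Inverses are therefore chosen classically, with the identity as default value off the units. *)
Definition polyfun_unit : {pred polyfun} :=
  fun F => `[< exists G, G * F = 1 >].

Definition polyfun_inv (F : polyfun) : polyfun :=
  if pselect (exists G, G * F = 1) is left h then projT1 (cid h) else F.

Lemma polyfun_mulV : {in polyfun_unit, left_inverse 1 polyfun_inv *%R}.
Proof.
move=> F /asboolP h; rewrite /polyfun_inv; case: pselect => // h'.
exact: projT2 (cid h').
Qed.

Lemma polyfun_unitP (F G : polyfun) : G * F = 1 -> polyfun_unit F.
Proof. by move=> GF; apply/asboolP; exists G. Qed.

Lemma polyfun_inv_out : {in [predC polyfun_unit], polyfun_inv =1 id}.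
Proof.
move=> F; rewrite inE unfold_in => /asboolPn h; rewrite /polyfun_inv.
by case: pselect.
Qed.

HB.instance Definition _ := GRing.ComNzRing_hasMulInverse.Build polyfun
  polyfun_mulV polyfun_unitP polyfun_inv_out.

Definition cst_pf (c : rat) : polyfun :=
  Polyfun (introT (asboolP _) (polynomial_cst c)).

Definition coord_pf (i : I) : polyfun :=
  Polyfun (introT (asboolP _) (polynomial_coord i)).

Lemma polyfun_elim (P : polyfun -> Prop) :
  (forall c, P (cst_pf c)) -> (forall i, P (coord_pf i)) ->
  (forall F G, P F -> P G -> P (F - G)) ->
  (forall F G, P F -> P G -> P (F * G)) -> forall F, P F.
Proof.
move=> Pc Pi PB PM [F FP]; have := FP; rewrite unfold_in => /asboolP H.
elim: H FP => [c|i|{}F G HF ihF HG ihG|{}F G HF ihF HG ihG] FP.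
- by rewrite (_ : Polyfun FP = cst_pf c) //; apply: val_inj.
- by rewrite (_ : Polyfun FP = coord_pf i) //; apply: val_inj.
- rewrite (_ : Polyfun FP = Polyfun (introT (asboolP _) HF)
                          - Polyfun (introT (asboolP _) HG)).
    exact: PB.
  exact: val_inj.
- rewrite (_ : Polyfun FP = Polyfun (introT (asboolP _) HF)
                          * Polyfun (introT (asboolP _) HG)).
    exact: PM.
  exact: val_inj.
Qed.

(** Passage to one variable, where a nonzero polynomial has only finitely many roots. *)
Lemma polyfun_line (F : polyfun) u w :
  exists p : {poly rat}, forall t, ev (fun i => u i + t * w i) F = p.[t].
Proof.
elim/polyfun_elim: F => [c|i|F G [p pF] [q qG]|F G [p pF] [q qG]].
- by exists c%:P => t; rewrite hornerC.
- by exists ((u i)%:P + (w i) *: 'X) => t; rewrite !hornerE mulrC.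
- by exists (p - q) => t; rewrite evB pF qG !hornerE.
- by exists (p * q) => t; rewrite evM pF qG !hornerE.
Qed.

Lemma infinite_roots0 (D : idomainType) (c : nat -> D) (p : {poly D}) :
  injective c -> (forall n, root p (c n)) -> p = 0.
Proof.
move=> cinj rp; apply: contrapT => /eqP p0.
have := @max_poly_roots _ p (map c (iota 0 (size p))) p0.
rewrite size_map size_iota ltnn => H; suff: false by []; apply: H.
  by apply/allP => _ /mapP [n _ ->].
by rewrite map_inj_uniq ?iota_uniq.
Qed.

Lemma natr_rat_inj : injective (fun n => n%:R : rat).
Proof. by move=> m n /eqP; rewrite eqr_nat => /eqP. Qed.

(* Two nonvanishing points span a line on which neither factor is zero. *)
Lemma polyfun_integral (F G : polyfun) : F * G = 0 -> (F == 0) || (G == 0).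
Proof.
move=> FG; apply: contrapT => /negP; rewrite negb_or => /andP[/eqP F0 /eqP G0].
have [u Fu] : exists u, ev u F <> 0.
  apply: contrapT => /forallNP H; apply: F0; apply: polyfunP => u.
  by rewrite ev0; apply: contrapT.
have [w Gw] : exists u, ev u G <> 0.
  apply: contrapT => /forallNP H; apply: G0; apply: polyfunP => w.
  by rewrite ev0; apply: contrapT.
have [p pF] := polyfun_line F u (fun i => w i - u i).
have [q qG] := polyfun_line G u (fun i => w i - u i).
have : p * q = 0.
  apply: (infinite_roots0 natr_rat_inj) => n.
  rewrite /root hornerM -pF -qG -evM.
  by rewrite FG ev0.
have E0 : (fun i => u i + 0 * (w i - u i)) = u.
  by apply/funext => i; rewrite mul0r addr0.
have E1 : (fun i => u i + 1 * (w i - u i)) = w.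
  by apply/funext => i; rewrite mul1r addrC subrK.
move/eqP; rewrite mulf_eq0 => /orP[] /eqP e.
  by apply: Fu; rewrite -E0 pF e horner0.
by apply: Gw; rewrite -E1 qG e horner0.
Qed.

HB.instance Definition _ :=
  GRing.ComUnitRing_isIntegral.Build polyfun polyfun_integral.

Definition dilate (W : set I) (z : rat) (u : I -> rat) : I -> rat :=
  fun i => if `[< W i >] then z * u i else u i.

(* [q] is [F] after the substitution of [z T_i] for [T_i], [i] in [W], as a
   polynomial in [z]. *)
Definition dilation (W : set I) (F : polyfun) (q : {poly polyfun}) : Prop :=
  forall z u, ev u q.[cst_pf z] = ev (dilate W z u) F.

Lemma dilationB W F G p q :
  dilation W F p -> dilation W G q -> dilation W (F - G) (p - q).
Proof. by move=> h k z u; rewrite hornerD hornerN !evB h k. Qed.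

Lemma dilationM W F G p q :
  dilation W F p -> dilation W G q -> dilation W (F * G) (p * q).
Proof. by move=> h k z u; rewrite hornerM !evM h k. Qed.

Lemma dilation1 W : dilation W 1 1.
Proof. by move=> z u; rewrite hornerC !ev1. Qed.

Lemma dilation_coord W i :
  dilation W (coord_pf i) ((if `[< W i >] then 'X else 1) * (coord_pf i)%:P).
Proof.
move=> z u; rewrite !hornerE evM {3}/ev /= /dilate.
by case: ifP; rewrite ?hornerE ?mul1r ?ev1 ?mul1r.
Qed.

(** The bound is chosen before [W]: the degree in the dilation parameter is at most the total degree
    of [F], whichever indeterminates are dilated. The uniform exponent in [vge_div_bound] rests on
    this. *)
Lemma dilation_ex (F : polyfun) : exists n, forall W,
  exists q : {poly polyfun}, (size q <= n)%N /\ dilation W F q.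
Proof.
elim/polyfun_elim: F => [c|i|F G [n hn] [m hm]|F G [n hn] [m hm]].
- exists 1%N => W; exists (cst_pf c)%:P; split; first exact: size_polyC_leq1.
  by move=> z u; rewrite hornerC.
- exists 2%N => W; exists ((if `[< W i >] then 'X else 1) * (coord_pf i)%:P).
  split; last exact: dilation_coord.
  apply: (leq_trans (size_polyMleq _ _)).
  rewrite -[2%N]/(2 + 1).-1%N -!subn1 leq_sub2r // leq_add ?size_polyC_leq1 //.
  by case: ifP; rewrite ?size_polyX ?size_poly1.
- exists (maxn n m) => W.
  have [p [sp dp]] := hn W; have [q [sq dq]] := hm W; exists (p - q).
  split; last exact: dilationB.
  apply: (leq_trans (size_polyD _ _)).
  by rewrite size_polyN geq_max !leq_max sp sq orbT.
- exists (n + m)%N => W.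
  have [p [sp dp]] := hn W; have [q [sq dq]] := hm W; exists (p * q).
  split; last exact: dilationM.
  apply: (leq_trans (size_polyMleq _ _)).
  exact: leq_trans (leq_pred _) (leq_add sp sq).
Qed.

(** Both polynomials agree at the infinitely many constants [cst_pf n%:R] of an integral domain. *)
Lemma dilation_uniq W F p q : dilation W F p -> dilation W F q -> p = q.
Proof.
move=> dp dq; apply/eqP; rewrite -subr_eq0; apply/eqP.
apply: (@infinite_roots0 _ (fun n => cst_pf n%:R)) => [m n|n].
  by move/(congr1 (ev (fun=> 0)))/natr_rat_inj.
apply/eqP; apply: polyfunP => u.
by rewrite hornerD hornerN evB dp dq subrr ev0.
Qed.

Lemma dilation_ex1 W F : exists q, dilation W F q.
Proof. by have [n /(_ W) [q [_ ?]]] := dilation_ex F; exists q. Qed.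

Definition phi W F : {poly polyfun} := projT1 (cid (dilation_ex1 W F)).
Lemma phiP W F : dilation W F (phi W F). Proof. exact: projT2 (cid _). Qed.

Lemma phiE W F q : dilation W F q -> phi W F = q.
Proof. exact/dilation_uniq/phiP. Qed.

Lemma phiB W : {morph phi W : F G / F - G}.
Proof. by move=> F G; apply: phiE; apply: dilationB; apply: phiP. Qed.

Lemma phiM W : {morph phi W : F G / F * G}.
Proof. by move=> F G; apply: phiE; apply: dilationM; apply: phiP. Qed.

Lemma phi1 W : phi W 1 = 1. Proof. exact/phiE/dilation1. Qed.

Lemma phi0 W : phi W 0 = 0. Proof. by rewrite -(subrr 0) phiB subrr. Qed.

Lemma phi_eq0 W F : (phi W F == 0) = (F == 0).
Proof.
apply/eqP/eqP => [e|->]; last exact: phi0.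
(* Dilation by 1 is the identity, so [F] is the value of [phi W F] at 1. *)
apply: polyfunP => u; have := phiP W F 1 u; rewrite e horner0 ev0 => ->.
by congr ev; apply/funext => i; rewrite /dilate mul1r; case: ifP.
Qed.

Lemma phi_size F : exists n, forall W, (size (phi W F) <= n)%N.
Proof.
have [n h] := dilation_ex F; exists n => W; have [q [sq dq]] := h W.
by rewrite (phiE dq).
Qed.

Lemma coord_pf_neq0 i : coord_pf i != 0.
Proof.
by apply/eqP => /(congr1 (ev (fun=> 1))); rewrite ev0 => /eqP; rewrite oner_eq0.
Qed.

Lemma ev_natr u n : ev u n%:R = n%:R.
Proof.
by elim: n => [|n ih]; rewrite ?ev0 // !mulrS -[ev u _]/(1 + ev u n%:R) ih.
Qed.

Lemma polyfun_natr_neq0 n : (n.+1%:R : polyfun) != 0.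
Proof.
apply/eqP => /(congr1 (ev (fun=> 0))).
by rewrite ev_natr ev0 => /eqP; rewrite pnatr_eq0.
Qed.

End PolynomialFunctions.

(** * Vanishing orders on the fraction field *)

Section VanishingOrder.
Context (I : Type).
Implicit Types (W : set I) (F G : polyfun I).
Local Notation "x %:F" := (@FracField.tofrac _ x).

Definition ratfun := {fraction polyfun I}.

Lemma ratfunP (a : ratfun) : exists F G, G != 0 /\ a = F%:F / G%:F.
Proof.
elim/quotP: a => r _.
have d0 := denom_ratioP r; exists (frac r).1, (frac r).2; split=> //.
rewrite -[_ / _]/(FracField.mul _ (FracField.inv _)) !piE.
apply/eqmodP; rewrite /= FracField.equivfE /FracField.mulf /FracField.invf.
rewrite !(numden_Ratio, oner_neq0) // ?mul1r ?mulr1 //.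
by rewrite mulrC.
Qed.

Definition psi W F : {poly ratfun} := map_poly (@FracField.tofrac _) (phi W F).

Lemma psiB W : {morph psi W : F G / F - G}.
Proof. by move=> F G; rewrite /psi phiB rmorphB. Qed.

Lemma psiM W : {morph psi W : F G / F * G}.
Proof. by move=> F G; rewrite /psi phiM rmorphM. Qed.

Lemma psi_eq0 W F : (psi W F == 0) = (F == 0).
Proof.
rewrite -(phi_eq0 W) /psi; have [->|p0] := eqVneq (phi W F) 0.
  by rewrite rmorph0 eqxx.
by rewrite map_poly_eq0_id0 ?(negPf p0) // tofrac_eq0 lead_coef_eq0.
Qed.

Lemma psi_size F : exists n, forall W, (size (psi W F) <= n)%N.
Proof.
have [n h] := phi_size F; exists n => W.
exact: leq_trans (size_poly _ _) (h W).
Qed.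

(* The order of vanishing of [F] along the [T_i], [i] in [W]. [mup] requires a
   field, hence the detour through [psi]. *)
Definition ord W F : nat := mup 0 (psi W F).

Lemma ordM W F G : F != 0 -> G != 0 -> ord W (F * G) = (ord W F + ord W G)%N.
Proof. by move=> F0 G0; rewrite /ord psiM mupM ?psi_eq0. Qed.

Local Notation z0 := ('X - 0%:P).

Lemma ord_geq W F n : F != 0 -> (n <= ord W F)%N = (z0 ^+ n %| psi W F).
Proof. by move=> F0; rewrite mup_geq ?psi_eq0. Qed.

Lemma ord_dvd W F : z0 ^+ ord W F %| psi W F.
Proof.
have [->|F0] := eqVneq F 0; last by rewrite -ord_geq.
by have /eqP -> : psi W 0 == 0 by rewrite psi_eq0.
Qed.

Lemma ord_size W F : F != 0 -> (ord W F < size (psi W F))%N.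
Proof.
move=> F0; rewrite -(size_exp_XsubC _ (0 : ratfun)).
by rewrite dvdp_leq ?psi_eq0 ?ord_dvd.
Qed.

Lemma tofrac_div_eq F G F' G' : G != 0 -> G' != 0 ->
  F%:F / G%:F = F'%:F / G'%:F -> F * G' = F' * G.
Proof.
move=> G0 G'0 /eqP; rewrite eqr_div ?tofrac_eq0 // -!tofracM tofrac_eq.
by move/eqP.
Qed.

(* The valuation of [a] extending [ord W] is at least [k]. *)
Definition vge W (k : nat) : set ratfun := [set a | exists F G,
  [/\ G != 0, a = F%:F / G%:F & z0 ^+ (k + ord W G) %| psi W F]].

(** The representing fraction does not matter, because [ord W] is additive on the cross-multiplied
    identity. A zero numerator is treated apart: everything divides it, so 0 has infinite
    valuation. *)
Lemma vge_div W k F G : G != 0 ->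
  vge W k (F%:F / G%:F) <-> z0 ^+ (k + ord W G) %| psi W F.
Proof.
move=> G0; split=> [[F' [G' [G'0 e d]]]|d]; last by exists F, G.
have {}e := tofrac_div_eq G0 G'0 e.
have [->|F0] := eqVneq F 0.
  by have /eqP -> : psi W 0 == 0; rewrite ?psi_eq0 ?dvdp0.
have F'0 : F' != 0.
  apply: contra_neq F0 => F'0; apply/eqP; move/eqP: e.
  by rewrite F'0 mul0r mulf_eq0 (negPf G'0) orbF.
move: d; rewrite -!ord_geq // => d.
have := congr1 (ord W) e; rewrite !ordM //; lia.
Qed.

Lemma vge_le W k l a : (k <= l)%N -> vge W l a -> vge W k a.
Proof.
move=> kl [F [G [G0 -> d]]]; exists F, G; split=> //.
by apply: dvdp_trans d; rewrite dvdp_exp2l // leq_add2r.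
Qed.

Lemma vgeB W k a b : vge W k a -> vge W k b -> vge W k (a - b).
Proof.
move=> [F [G [G0 -> d]]] [F' [G' [G'0 -> d']]].
exists (F * G' - F' * G), (G * G'); split; first by rewrite mulf_neq0.
  by rewrite -mulNr addf_div ?tofrac_eq0 // tofracB !tofracM mulNr.
rewrite psiB !psiM ordM // dvdp_sub //.
  by rewrite addnA exprD dvdp_mul ?ord_dvd.
by rewrite (addnC (ord W G)) addnA exprD dvdp_mul ?ord_dvd.
Qed.

Lemma vgeM W k l a b : vge W k a -> vge W l b -> vge W (k + l) (a * b).
Proof.
move=> [F [G [G0 -> d]]] [F' [G' [G'0 -> d']]].
exists (F * F'), (G * G'); split; first by rewrite mulf_neq0.
  by rewrite mulf_div !tofracM.
by rewrite psiM ordM // addnACA exprD dvdp_mul.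
Qed.

Lemma vge0 W k : vge W k 0.
Proof.
exists 0, 1; rewrite tofrac0 mul0r oner_neq0; split=> //.
by have /eqP -> : psi W 0 == 0; rewrite ?psi_eq0 ?dvdp0.
Qed.

Lemma vgeX W k n a : vge W k a -> (0 < n)%N -> vge W (n * k) (a ^+ n).
Proof.
move=> va; case: n => // n _; elim: n => [|n ih]; first by rewrite mul1n.
by rewrite exprS mulSn; apply: vgeM.
Qed.

(** The hypotheses force valuation exactly 0: numerator and denominator have the same order. *)
Lemma vge_inv W a : vge W 0 a -> ~ vge W 1 a -> vge W 0 a^-1.
Proof.
move=> [F [G [G0 -> d]]]; rewrite vge_div // => nd.
have F0 : F != 0.
  apply: contra_notN nd => /eqP ->.
  by have /eqP -> : psi W 0 == 0; rewrite ?psi_eq0 ?dvdp0.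
rewrite invf_div; apply/vge_div => //; move: d nd.
rewrite -!ord_geq // => d /negP; rewrite -ltnNge; lia.
Qed.

(* The bound is uniform in [W]: the valuations of [a] are at most the degree of
   its numerator. *)
Lemma vge_div_bound a : a != 0 ->
  exists N, forall W n b, (N < n)%N -> vge W 1 b -> vge W 1 (b ^+ n / a).
Proof.
have [F [G [G0 ->]]] := ratfunP a => FG.
have F0 : F != 0 by apply: contra_neq FG => ->; rewrite tofrac0 mul0r.
have [N hN] := psi_size F; exists N => W n b Nn vb.
have := vgeX vb (leq_ltn_trans (leq0n _) Nn); rewrite muln1.
move=> [F' [G' [G'0 -> d]]]; rewrite invf_div mulf_div -!tofracM.
apply/vge_div; first by rewrite mulf_neq0.
rewrite psiM ordM // dvdp_mulr //; apply: dvdp_trans d.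
by rewrite dvdp_exp2l //; have := ord_size W F0; have := hN W; lia.
Qed.

(* A subfield on which the valuation is trivial and which contains the [T_i] with
   [i] outside [W]. *)
Definition Kfix W : set ratfun := [set a | exists F G,
  [/\ G != 0, a = F%:F / G%:F, phi W F = F%:P & phi W G = G%:P]].

Lemma Kfix_div W F G : G != 0 -> phi W F = F%:P -> phi W G = G%:P ->
  Kfix W (F%:F / G%:F).
Proof. by move=> *; exists F, G. Qed.

Lemma Kfix0 W : Kfix W 0.
Proof. by exists 0, 1; rewrite tofrac0 mul0r oner_neq0 phi0 phi1. Qed.

Lemma Kfix1 W : Kfix W 1.
Proof. by exists 1, 1; rewrite tofrac1 divr1 oner_neq0 phi1. Qed.

Lemma KfixB W a b : Kfix W a -> Kfix W b -> Kfix W (a - b).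
Proof.
move=> [F [G [G0 -> f g]]] [F' [G' [G'0 -> f' g']]].
rewrite -mulNr addf_div ?tofrac_eq0 // mulNr -!tofracM -tofracB.
apply: Kfix_div; rewrite ?mulf_neq0 // ?phiB !phiM ?f ?g ?f' ?g'.
  by rewrite polyCB !polyCM.
by rewrite polyCM.
Qed.

Lemma KfixM W a b : Kfix W a -> Kfix W b -> Kfix W (a * b).
Proof.
move=> [F [G [G0 -> f g]]] [F' [G' [G'0 -> f' g']]].
rewrite mulf_div -!tofracM.
by apply: Kfix_div; rewrite ?mulf_neq0 // !phiM ?f ?g ?f' ?g' !polyCM.
Qed.

Lemma KfixV W a : Kfix W a -> Kfix W a^-1.
Proof.
move=> [F [G [G0 -> f g]]]; have [->|F0] := eqVneq F 0.
  by rewrite tofrac0 mul0r invr0; apply: Kfix0.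
by rewrite invf_div; apply: Kfix_div.
Qed.

Lemma ord_fix W F : F != 0 -> phi W F = F%:P -> ord W F = 0%N.
Proof.
move=> F0 f; have := ord_size W F0; rewrite /psi f map_polyC size_polyC.
by case: eqP => // _; case: (ord _ _).
Qed.

Lemma Kfix_vge W a : Kfix W a -> vge W 0 a.
Proof.
move=> [F [G [G0 -> f g]]]; apply/vge_div => //.
by rewrite (ord_fix G0 g) expr0 dvd1p.
Qed.

(** A subfield with trivial valuation meets the maximal ideal of the valuation ring only in 0.
    Values of functions in the ring are recognized as zero in this way. *)
Lemma Kfix_vge1 W a : Kfix W a -> vge W 1 a -> a = 0.
Proof.
move=> [F [G [G0 -> f g]]] /vge_div => /(_ G0); rewrite (ord_fix G0 g).
have [->|F0] := eqVneq F 0; first by rewrite tofrac0 mul0r.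
by rewrite -ord_geq // (ord_fix F0 f).
Qed.

Definition indet i : ratfun := (coord_pf i)%:F.

Lemma indet_neq0 i : indet i != 0.
Proof. by rewrite tofrac_eq0 coord_pf_neq0. Qed.

Lemma indet_vge W i : W i -> vge W 1 (indet i).
Proof.
move=> Wi; have -> : indet i = (coord_pf i)%:F / 1%:F by rewrite tofrac1 divr1.
apply/vge_div; first exact: oner_neq0.
rewrite (ord_fix (oner_neq0 _)) ?phi1 // expr1 /psi.
have /phiE -> := dilation_coord W i; case: asboolP => // _.
by rewrite rmorphM /= map_polyX subr0 dvdp_mulIl.
Qed.

Lemma indet_fix W i : ~ W i -> Kfix W (indet i).
Proof.
move=> Wi; have -> : indet i = (coord_pf i)%:F / 1%:F by rewrite tofrac1 divr1.
apply: Kfix_div; rewrite ?oner_neq0 ?phi1 //.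
by have /phiE -> := dilation_coord W i; case: asboolP => // _; rewrite mul1r.
Qed.

Lemma ratfun_natr_inj : injective (fun n => n%:R : ratfun).
Proof.
suff H (m n : nat) : (m < n)%N -> m%:R != n%:R :> ratfun.
  move=> m n /eqP e; case: (ltngtP m n) => // /H; first by rewrite e.
  by rewrite eq_sym e.
move=> mn; rewrite eq_sym -subr_eq0 -natrB ?(ltnW mn) //.
have : (0 < n - m)%N by rewrite subn_gt0.
case: (n - m)%N => // k _.
by rewrite -tofrac1 -tofracMn tofrac_eq0 polyfun_natr_neq0.
Qed.

End VanishingOrder.

(** * Hochster's theorem *)

Section Finitary.
Context (X : Type) (I : eqType) (D : I -> set X).

Definition finitary (T : Type) (f : X -> T) : Prop := exists s : seq I,
  forall x y, (forall i, i \in s -> (D i x <-> D i y)) -> f x = f y.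

Lemma finitary_map2 (T T' T'' : Type) (op : T -> T' -> T'') f g :
  finitary f -> finitary g -> finitary (fun x => op (f x) (g x)).
Proof.
move=> [s fs] [s' gs']; exists (s ++ s') => x y xy.
rewrite (fs x y) ?(gs' x y) // => i is_;
  by apply: xy; rewrite mem_cat is_ ?orbT.
Qed.

Lemma finitary_cst (T : Type) (c : T) : finitary (fun=> c).
Proof. by exists [::]. Qed.

Lemma finitary_range (T : eqType) (f : X -> T) :
  finitary f -> exists vs : seq T, forall x, f x \in vs.
Proof.
move=> [s fs].
pose agree (s : seq I) x y := forall i : I, i \in s -> (D i x <-> D i y).
(* Generalizing to a subset [S] lets the induction on the list split it along [D i]. *)
suff H (S : set X) : (forall x y, S x -> S y -> agree s x y -> f x = f y) ->
    exists vs : seq T, forall x, S x -> f x \in vs.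
  have [|vs h] := H setT; first by move=> x y _ _; apply: fs.
  by exists vs => x; apply: h.
elim: s {fs} S => [|i s ih] S fS.
  have [[x Sx]|S0] := pselect (S !=set0).
    by exists [:: f x] => y Sy; rewrite inE (fS y x).
  by exists [::] => x Sx; case: S0; exists x.
have [|vs h] := ih (S `&` D i).
  move=> x y [Sx ix] [Sy iy] xy; apply: fS => // j.
  by rewrite inE => /orP[/eqP -> //|/xy].
have [|vs' h'] := ih (S `&` ~` D i).
  move=> x y [Sx ix] [Sy iy] xy; apply: fS => // j.
  by rewrite inE => /orP[/eqP -> //|/xy].
exists (vs ++ vs') => x Sx; rewrite mem_cat.
by have [ix|ix] := pselect (D i x); [rewrite h|rewrite h' ?orbT].
Qed.

(** For an ultrafilter this is convergence in the constructible topology, which the [D i] and their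
    complements generate. *)
Definition ultralimit (F : set_system X) (y : X) : Prop :=
  forall i, F (D i) <-> D i y.

Lemma ultralimit_finitary (F : set_system X) y (T : Type) (f : X -> T) :
  UltraFilter F -> ultralimit F y -> finitary f -> F [set x | f x = f y].
Proof.
move=> FU Fy [s fs].
have : F [set x | forall i, i \in s -> (D i x <-> D i y)].
  elim: s {fs} => [|i s ih]; first by apply: filterS filterT.
  have Fi : F [set x | D i x <-> D i y].
    have [/Fy Fi|nFi] := in_ultra_setVsetC (D i) FU.
      by apply: filterS ((Fy i).2 Fi).
    have nDy : ~ D i y.
      move=> /Fy /(filterI nFi); rewrite setICl.
      exact: filter_not_empty.
    by apply: filterS nFi => x /= nx; split.
  apply: filterS (filterI Fi ih) => x [/= xi xs] j.
  by rewrite inE => /orP[/eqP -> //|/xs].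
by apply: filterS => x; apply: fs.
Qed.

End Finitary.

(** The right-hand side isolates [u - v] and [s - t], which have positive valuation when a quotient
    is tested for membership in the ring. *)
Lemma sub_fractions (F : fieldType) (u v s t : F) : s != 0 -> t != 0 ->
  u / s - v / t = ((u - v) * t - v * (s - t)) * (s^-1 * t^-1).
Proof. by move=> s0 t0; field; rewrite s0 t0. Qed.

Lemma Spec_eq (A : comPzRingType) (p q : Spec A) : p = q :> set A -> p = q.
Proof.
case: p q => [p pP] [q qP] /= e; subst q.
by congr SpecPoint; apply: Prop_irrelevance.
Qed.

Lemma open_Spec_notin (A : comPzRingType) (a : A) :
  open [set P : Spec A | ~ Spec_set P a].
Proof.
exists [set b : A | exists h, b = h * a].
  split; first by exists 0; rewrite mul0r.
    by move=> _ _ [h ->] [h' ->]; exists (h + h'); rewrite mulrDl.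
  by move=> r _ [h ->]; exists (r * h); rewrite mulrA.
apply/seteqP; split=> P /=.
  move=> /contrapT PI _ [h ->]; have [[_ _ PM] _ _] := Spec_prime P.
  exact: PM.
by move=> h; apply; apply: h; exists 1; rewrite mul1r.
Qed.

(** * The ring of functions whose prime spectrum is X *)

Section Hochster.
Context (X : topologicalType) (I : eqType) (D : I -> set X).
Context (D_open : forall i, open (D i)).
Context (D_base : forall (U : set X) x, open U -> U x ->
  exists2 i, D i x & D i `<=` U).
Context (D_sep : forall x y, (forall i, D i x <-> D i y) -> x = y).
Context (D_compact : forall F : set_system X, UltraFilter F ->
  exists y, ultralimit D F y).

Local Notation K := (ratfun I).
Local Notation W x := [set i | ~ D i x].
Local Notation generizes y x := (forall i, D i x -> D i y).

(* Residues are required to agree: [f x] is the residue of [f y] in the valuation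
   attached to [x]. This is stable under sums, while it makes [f y] vanish to
   positive order exactly when [f x = 0]. *)
Definition spring_pred : {pred (X -> K)} := fun f => `[<
  [/\ finitary D f, forall x, Kfix (W x) (f x) &
    forall x y, generizes y x -> vge (W x) 1 (f y - f x)] >].

Record spring := Spring {
  spring_val :> X -> K;
  _ : spring_val \in spring_pred
}.

HB.instance Definition _ := [isSub for spring_val].
HB.instance Definition _ := [Choice of spring by <:].

Lemma spring_vge0 (f : X -> K) x y :
  Kfix (W x) (f x) -> vge (W x) 1 (f y - f x) -> vge (W x) 0 (f y).
Proof.
move=> fx fyx; have -> : f y = (f y - f x) - (0 - f x).
  by rewrite sub0r opprK subrK.
apply: vgeB; first exact: vge_le fyx.
by apply: vgeB; [exact: vge0|exact: Kfix_vge].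
Qed.

Lemma spring_subring_closed : subring_closed spring_pred.
Proof.
split; rewrite ?unfold_in.
- apply/asboolP; split=> [|x|x y _]; [exact: finitary_cst|exact: Kfix1|].
  by rewrite /= subrr; apply: vge0.
- move=> f g; rewrite !unfold_in => /asboolP [ff kf vf] /asboolP [fg kg vg].
  apply/asboolP; split=> [|x|x y yx].
  + exact: (finitary_map2 (fun a b => a - b)).
  + exact: KfixB.
  + rewrite [X in vge _ _ X](_ : _ = (f y - f x) - (g y - g x)).
      by apply: vgeB; [apply: vf|apply: vg].
    by rewrite !fctE; ring.
- move=> f g; rewrite !unfold_in => /asboolP [ff kf vf] /asboolP [fg kg vg].
  apply/asboolP; split=> [|x|x y yx].
  + exact: (finitary_map2 (fun a b => a * b)).
  + exact: KfixM.
  (* The product rule for differences, with the sum written through [0 -] so that [vgeB] applies. *)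
  + rewrite [X in vge _ _ X](_ : _ =
        (f y - f x) * g y - (0 - f x * (g y - g x))).
      apply: vgeB.
        rewrite -[1%N]addn0; apply: vgeM; first exact: vf.
        exact: spring_vge0 (vg _ _ yx).
      apply: vgeB; first exact: vge0.
      by rewrite -[1%N]add0n; apply: vgeM; [apply: Kfix_vge|exact: vg].
    by rewrite !fctE; ring.
Qed.

HB.instance Definition _ :=
  GRing.SubChoice_isSubComPzRing.Build _ _ spring spring_subring_closed.

Implicit Types f g a b c : spring.

Lemma springP f : [/\ finitary D f, forall x, Kfix (W x) (f x) &
    forall x y, generizes y x -> vge (W x) 1 (f y - f x)].
Proof. by case: f => f /= fP; move: (fP); rewrite unfold_in => /asboolP. Qed.

Lemma springD f g x : (f + g) x = f x + g x.
Proof. by []. Qed.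

Lemma springM f g x : (f * g) x = f x * g x.
Proof. by []. Qed.

Lemma springX f n x : (f ^+ n) x = f x ^+ n.
Proof. by elim: n => [|n ih]; rewrite ?expr0 // !exprS springM ih. Qed.

Lemma springMn f n x : (f *+ n) x = f x *+ n.
Proof. by elim: n => [|n ih]; rewrite ?mulr0n // !mulrS springD ih. Qed.

(** The residue of 0 is 0: if [f y] vanishes, then [f x] has positive valuation while lying in the
    trivially valued subfield. *)
Lemma spring_generize f x y : generizes y x -> f y = 0 -> f x = 0.
Proof.
move=> yx fy; have [_ kf vf] := springP f.
apply: (Kfix_vge1 (kf x)); rewrite -[f x]subr0 -opprB.
by rewrite -fy -[- _]add0r; apply: vgeB; [exact: vge0|exact: vf].
Qed.

(** If [x] were not interior, the neighbourhoods of [x] would trace a proper filter on the zero set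
    of [f]. The limit [y] of an ultrafilter refining it generizes [x], since every [D i] around [x]
    is a neighbourhood, and [f y = 0] because [f] is finitary. Then [f x = 0], a contradiction. *)
Lemma spring_open f : open [set x | f x != 0].
Proof.
rewrite openE => x /= fx0; apply: contrapT => nx.
have PF : ProperFilter (within [set x | f x = 0] (nbhs x)).
  apply: Build_ProperFilter_ex => P Px.
  apply: contrapT => /forallNP nP; apply: nx; rewrite /interior.
  have {}Px : nbhs x [set y | f y = 0 -> P y] := Px.
  by apply: filterS Px => y /= Py; apply/eqP => /Py /nP.
have [F [FU FP]] := ultraFilterLemma PF.
have [y Fy] := D_compact FU.
have yx : generizes y x.
  move=> i ix; apply/Fy/FP; have Di : nbhs x (D i) by apply: open_nbhs_nbhs.
  have : nbhs x [set z | f z = 0 -> D i z] by apply: filterS Di => z Dz _.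
  by [].
have [ff _ _] := springP f.
have F0 : F [set x | f x = 0].
  have : nbhs x [set z | f z = 0 -> f z = 0].
    by apply: filterS filterT => z _ fz.
  exact: FP.
have Ff := ultralimit_finitary FU Fy ff.
have [z [/= fz fzy]] := filter_ex (filterI F0 Ff).
by move/eqP: fx0; apply; apply: (spring_generize yx); rewrite -fzy.
Qed.

Lemma spring_dvd a b : (forall x, a x = 0 -> b x = 0) ->
  exists n c, b ^+ n = c * a.
Proof.
move=> ab; have [fa ka va] := springP a; have [fb kb vb] := springP b.
have [vs avs] := finitary_range fa.
(* One exponent serves all the nonzero values of [a] and all valuations. Its form [n.+1] makes the
   power of [b] vanish wherever [b] does. *)
have [n hn] : exists n, forall z, z \in vs -> z != 0 -> forall W d,
    vge W 1 d -> vge W 1 (d ^+ n.+1 / z).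
  suff [n hn] : exists n, forall z, z \in vs -> z != 0 -> forall W m d,
      (n < m)%N -> vge W 1 d -> vge W 1 (d ^+ m / z).
    by exists n => z zvs z0 W d; apply: hn.
  elim: vs {avs} => [|z vs [n hn]]; first by exists 0%N.
  have [->|z0] := eqVneq z 0.
    exists n => u; rewrite inE => /orP[/eqP ->|]; first by rewrite eqxx.
    exact: hn.
  have [m hm] := vge_div_bound z0; exists (maxn n m) => u.
  rewrite inE => /orP[/eqP -> _|uvs u0] W k d; rewrite gtn_max => /andP[nk mk].
    exact: hm.
  exact: hn.
(* Where [a] vanishes, [c] is 0, as the inverse of 0 is 0. *)
pose c x := b x ^+ n.+1 / a x.
have cP : c \in spring_pred.
  rewrite unfold_in; apply/asboolP; split=> [|x|x y yx].
  - exact: (finitary_map2 (fun u v => v ^+ n.+1 / u)).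
  - apply: KfixM; last exact/KfixV.
    elim: (n.+1) => [|k ih]; first by rewrite expr0; apply: Kfix1.
    by rewrite exprS; apply: KfixM.
  rewrite /c; have [ax0|ax0] := eqVneq (a x) 0.
    (* Here [b x = 0], so [b y] has positive valuation and the choice of [n] applies. *)
    rewrite (ab _ ax0) expr0n /= mul0r subr0.
    have [ay0|ay0] := eqVneq (a y) 0.
      by rewrite ay0 invr0 mulr0; apply: vge0.
    apply: hn => //; rewrite -[b y]subr0 -(ab _ ax0); exact: vb.
  (* Here [a y] has the nonzero residue [a x], so both denominators are units of the valuation
     ring. *)
  have ay0 : a y != 0 by apply: contra_neq ax0; apply: spring_generize.
  have [_ kN vN] := springP (b ^+ n.+1).
  rewrite -!springX; set bn := b ^+ n.+1 in kN vN *.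
  have -> := sub_fractions (bn y) (bn x) ay0 ax0.
  have kax : vge (W x) 0 (a x) by apply: Kfix_vge.
  rewrite -[1%N]addn0; apply: vgeM.
    apply: vgeB.
      by rewrite -[1%N]addn0; apply: vgeM => //; apply: vN.
    by rewrite -[1%N]add0n; apply: vgeM; [apply: Kfix_vge|apply: va].
  rewrite -[0%N]addn0; apply: vgeM; last by apply/Kfix_vge/KfixV.
  apply: vge_inv; first exact: spring_vge0 (va _ _ yx).
  move=> vay; move/eqP: ax0; apply; apply: (Kfix_vge1 (ka x)).
  rewrite -[a x](subKr (a y)); apply: vgeB => //; exact: va.
exists n.+1, (Spring cP); apply: val_inj; apply/funext => x.
rewrite [LHS]springX [RHS]springM /= /c.
have [ax0|ax0] := eqVneq (a x) 0; last by rewrite divfK.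
by rewrite ax0 mulr0 (ab _ ax0) expr0n.
Qed.

(** The quotient [- f / g] takes finitely many values, and in characteristic 0 some natural number
    [n] is not among them. *)
Lemma spring_combination f g :
  exists n, forall x, (f + g *+ n) x = 0 -> f x = 0 /\ g x = 0.
Proof.
have [ff _ _] := springP f; have [fg _ _] := springP g.
have [vs hvs] := finitary_range (finitary_map2 (fun u v => - u / v) ff fg).
have [n nvs] : exists n, (n%:R : K) \notin vs.
  apply: contrapT => /forallNP H.
  have : (size (map (fun n => n%:R : K) (iota 0 (size vs).+1)) <= size vs)%N.
    apply: uniq_leq_size.
      by rewrite map_inj_uniq ?iota_uniq //; apply: ratfun_natr_inj.
    by move=> _ /mapP [k _ ->]; apply/negPn/negP/H.
  by rewrite size_map size_iota ltnn.
exists n => x; rewrite springD springMn => /eqP; rewrite addr_eq0 => /eqP e.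
have g0 : g x = 0.
  apply/eqP/negPn/negP => gx0; move/negP: nvs; apply.
  by have := hvs x; rewrite e opprK -[g x *+ n]mulr_natl mulfK.
by rewrite e g0 mul0rn oppr0.
Qed.

Lemma spring_at_prime x : prime_ideal [set f : spring | f x = 0].
Proof.
split.
- split=> [//|f g /= f0 g0|f g /= g0].
    by rewrite -[LHS]/(f x + g x) f0 g0 addr0.
  by rewrite -[LHS]/(f x * g x) g0 mulr0.
- move=> e; have : [set f : spring | f x = 0] 1 by rewrite e.
  by move/eqP; rewrite -[X in X == 0]/(1 : K) oner_eq0.
- move=> f g /eqP; rewrite -[X in X == 0]/(f x * g x) mulf_eq0.
  by move=> /orP[/eqP|/eqP]; [left|right].
Qed.

Definition spring_point x : Spec spring := SpecPoint (spring_at_prime x).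

Lemma spring_coord_in i :
  (fun x => if `[< D i x >] then indet i else 0) \in spring_pred.
Proof.
rewrite unfold_in; apply/asboolP; split=> [|x|x y yx].
- exists [:: i] => x y xy; congr (if _ then _ else _).
  by apply/asbool_equiv_eq/xy; rewrite inE.
- case: asboolP => ix; last exact: Kfix0.
  by apply: indet_fix => /=; apply.
(* The case with content has [y] in [D i] and [x] outside: then [i] belongs to [W x], and the
   indeterminate has positive order there. *)
- case: asboolP => iy; case: asboolP => ix; rewrite ?subr0 ?subrr.
  + exact: vge0.
  + exact: indet_vge.
  + by case: iy; apply: yx.
  + exact: vge0.
Qed.

Definition spring_coord i : spring := Spring (spring_coord_in i).

Lemma spring_coordE i x : spring_coord i x = 0 <-> ~ D i x.
Proof.
rewrite /=; case: asboolP => ix; split=> // /eqP.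
by rewrite (negPf (indet_neq0 i)).
Qed.

Lemma spring_point_inj : injective spring_point.
Proof.
move=> x y /(congr1 (@Spec_set _)) e; apply: D_sep => i.
have e' : spring_coord i x = 0 <-> spring_coord i y = 0.
  by rewrite -[_ x = 0]/(Spec_set (spring_point x) (spring_coord i)) e.
move: e'; rewrite !spring_coordE => -[h h'].
by split=> H; apply: contrapT; [move/h'|move/h].
Qed.

(** The sets where [a] vanishes and [g] does not, for [a] in [P] and [g] outside, form a filter
    base: [spring_combination] handles intersections, and an empty set would put a power of [g] in
    [P] by [spring_dvd]. At the limit of an ultrafilter refining it, exactly the members of [P]
    vanish. *)
Lemma spring_point_surj (P : Spec spring) : exists x, spring_point x = P.
Proof.
have [[P0 PD PM] PT PP] := Spec_prime P.
pose idx := [set ag : spring * spring | Spec_set P ag.1 /\ ~ Spec_set P ag.2].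
pose B (ag : spring * spring) := [set x : X | ag.1 x = 0 /\ ag.2 x <> 0].
have P1 : ~ Spec_set P 1.
  move=> P1; apply: PT; apply/seteqP; split=> // f _.
  by rewrite -[f]mulr1; apply: PM.
have PX b n : Spec_set P (b ^+ n) -> Spec_set P b.
  by elim: n => [|n ih]; rewrite ?expr0 // exprS => /PP [].
have PF : ProperFilter (filter_from idx B).
  apply: filter_from_proper.
    apply: filter_from_filter; first by exists (0, 1).
    move=> [a g] [a' g'] [/= Pa Pg] [/= Pa' Pg'].
    have [n hn] := spring_combination a a'.
    exists (a + a' *+ n, g * g') => /=.
      split=> /=; last by case/PP.
      by apply: PD => //; rewrite -mulr_natl; apply: PM.
    move=> x [/hn [ax a'x] /eqP].
    rewrite -[X in X != 0]/(g x * g' x) mulf_eq0 negb_or.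
    by move=> /andP[/eqP gx /eqP g'x].
  move=> [a g] [/= Pa Pg]; apply: contrapT => /forallNP nB.
  have [x ax|n [c e]] := @spring_dvd a g.
    by apply: contrapT => gx; apply: (nB x).
  by apply: Pg; apply: (PX _ n); rewrite e; apply: PM.
have [F [FU FB]] := ultraFilterLemma PF.
have [y Fy] := D_compact FU; exists y; apply: Spec_eq.
apply/seteqP; split=> f /= fy; have [ff _ _] := springP f;
    have Ff := ultralimit_finitary FU Fy ff.
  apply: contrapT => Pf.
  have F0f : F (B (0, f)) by apply: FB; exists (0, f).
  have [x [/= fx [_ /=]]] := filter_ex (filterI Ff F0f).
  by rewrite fx fy.
have Ff1 : F (B (f, 1)) by apply: FB; exists (f, 1).
by have [x [/= <- []]] := filter_ex (filterI Ff Ff1).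
Qed.

Theorem hochster_spectral : spectral_space X.
Proof.
exists spring; have [g gK] := choice spring_point_surj.
have fK : cancel spring_point g by move=> x; apply: spring_point_inj.
exists spring_point, g; split=> //.
  apply/continuousP => U [J _ eU].
  have -> : spring_point @^-1` U = \bigcup_(f in J) [set x | f x != 0].
    rewrite -[U]setCK eU; apply/seteqP; split=> x /=.
      move=> /existsNP [f /not_implyP [Jf /eqP fx]].
      by exists f.
    by move=> [f Jf /eqP fx] /(_ f Jf).
  by apply: bigcup_open => f _; apply: spring_open.
apply/continuousP => U oU.
(* As [spring_coord i] vanishes exactly off [D i], the set [D i] corresponds to a basic open set of
   the spectrum. *)
have -> : g @^-1` U = \bigcup_(i in [set i | D i `<=` U])
    [set P : Spec spring | ~ Spec_set P (spring_coord i)].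
  apply/seteqP; split=> [P /= UgP|P [i /= iU]].
    have [i ix iU] := D_base oU UgP; exists i => //=.
    by rewrite -(gK P) /= => /spring_coordE.
  by rewrite -{1}(gK P) /= => /spring_coordE/contrapT/iU.
by apply: bigcup_open => i _; apply: open_Spec_notin.
Qed.

End Hochster.

(** * The graded primary spectrum *)

Lemma card_leI1P (T : Type) (A : set T) :
  (A #<= `I_1)%card <-> forall x y, A x -> A y -> x = y.
Proof.
split=> [/pcard_leP/unsquash f x y Ax Ay|H].
  have I0 z : A z -> f z = 0%N.
    by move=> Az; have : `I_1 (f z) by [apply: funS]; case: (f z).
  apply: (@inj _ _ _ f x y (mem_set Ax) (mem_set Ay)).
  exact: etrans (I0 x Ax) (esym (I0 y Ay)).
have [[x Ax]|A0] := pselect (A !=set0).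
  rewrite -(card_le_eqr (@card_set1 _ x)); apply: subset_card_le => y Ay.
  exact: H.
rewrite (_ : A = set0) ?card_ge0 //.
by apply/seteqP; split=> // x Ax; case: A0; exists x.
Qed.

Section PrimarySpectrum.
Context (G : groupType) (R : comPzRingType) (RG : ring_grading G R).
Context (M : lmodType R) (MG : module_grading RG M).
Implicit Types (Q : PS_G MG) (a : R).
Local Notation p Q := (colon (Gr_M MG (PSG_set Q))).

Definition basic_open a : set (PS_G MG) := [set Q | ~ p Q a].

Lemma basic_open_open a : open (basic_open a).
Proof.
(* The smallest graded submodule containing [a M]; its colon lies in [p Q] exactly when [a] does. *)
exists (\bigcap_(N in
  [set N | graded_submodule MG N /\ forall m, N (a *: m)]) N).
  by apply: graded_submodule_bigcap => N [].
rewrite /basic_open; apply/seteqP; split=> Q /= => [/contrapT pa|H].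
  apply: colonS => m; apply; split; first exact: Gr_M_graded.
  exact: pa.
by apply; apply: H => m N [].
Qed.

Lemma basic_open_base (U : set (PS_G MG)) Q : open U -> U Q ->
  exists2 a, basic_open a Q & basic_open a `<=` U.
Proof.
move=> [N gN eU] UQ.
have nuP Q' : U Q' <-> ~ nu_G MG N Q'.
  by rewrite -eU; split=> [UQ' /(_ UQ')|/contrapT].
have /nuP /existsNP [a /not_implyP [Na pa]] := UQ.
by exists a => // Q' pa'; apply/nuP => /(_ a Na).
Qed.

Lemma colon_Gr_ideal Q : ideal (p Q).
Proof. by apply: colon_ideal; have [] := Gr_M_graded MG Q. Qed.

Lemma PS_G_closureP Q Q' : closure [set Q] Q' <-> p Q `<=` p Q'.
Proof.
split=> [cl a pa|pQ U].
  apply: contrapT => npa.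
  have [|_ [-> ]] := cl (basic_open a); last by [].
  by apply: open_nbhs_nbhs; split; first exact: basic_open_open.
rewrite nbhsE => -[V [oV VQ'] VU]; exists Q; split=> //; apply: VU.
have [a pa aV] := basic_open_base oV VQ'.
by apply: aV => /pQ.
Qed.

(** The set [nu_G MG Q] is defined by [colon Q], whose graded radical is [p Q]; a graded prime
    contains both or neither. *)
Lemma nu_GP Q Q' : nu_G MG Q Q' <-> p Q `<=` p Q'.
Proof.
rewrite /nu_G /=; split=> [H a|H]; last first.
  apply: subset_trans H; apply: colonS => m Qm P [_]; exact.
rewrite PSG_radical => -[f df Hf].
have [p0 pD _] := colon_Gr_ideal Q'; apply: (decomposes_in p0 pD df) => g.
have [n n0 /H] := Hf g.
have [gp _ pp] := PS_G_prime Q'; have [/(_ g) fg _ _] := df.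
elim: n n0 => // n ih _; case: n ih => [_|n ih]; first by rewrite expr1.
rewrite exprS => /pp [||//|/ih]; [by exists g|exact: rpartX fg|exact].
Qed.

Lemma nu_G_inj Q Q' : nu_G MG Q = nu_G MG Q' <-> p Q = p Q'.
Proof.
split=> [e|e]; last first.
  by apply/seteqP; split=> P /nu_GP H; apply/nu_GP; move: H; rewrite e.
apply/seteqP; split; apply/nu_GP; first by rewrite e; apply/nu_GP.
by rewrite -e; apply/nu_GP.
Qed.

Lemma closure_PS_G_inj Q Q' :
  closure [set Q] = closure [set Q'] <-> p Q = p Q'.
Proof.
split=> [e|e]; last first.
  apply/seteqP; split=> P /PS_G_closureP H; apply/PS_G_closureP; move: H;
    by rewrite e.
apply/seteqP; split; apply/PS_G_closureP.
  by rewrite e; apply/PS_G_closureP.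
by rewrite -e; apply/PS_G_closureP.
Qed.

Lemma Ann_colon Q : Ann M `<=` p Q.
Proof. by apply: colonS => _ ->; have [[]] := Gr_M_graded MG Q. Qed.

Lemma toRbar_image (q : set R) a : ideal q -> Ann M `<=` q ->
  (toRbar M @` q) (toRbar M a) <-> q a.
Proof.
move=> [_ qD qM] Aq; split=> [[b qb /toRbar_eq /Aq]|qa]; last by exists a.
move=> /(qM (-1)); rewrite mulN1r opprB => /qD /(_ qb).
by rewrite subrK.
Qed.

Lemma rho_eq Q (q : set R)
    (qP : graded_prime_ideal (Rbar_grading MG) (toRbar M @` q)) :
  ideal q -> Ann M `<=` q -> rho MG Q = SpecG qP <-> p Q = q.
Proof.
move=> iq Aq; split=> [/(congr1 (@SpecG_set _ _ _)) /= e|e].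
  apply/seteqP; split=> a.
    move=> /(toRbar_image _ (colon_Gr_ideal Q) (@Ann_colon Q)).
    by rewrite e => /toRbar_image; apply.
  move=> /(toRbar_image _ iq Aq); rewrite -e => /toRbar_image.
  by apply; [exact: colon_Gr_ideal|exact: Ann_colon].
subst q; rewrite /rho; congr SpecG; exact: Prop_irrelevance.
Qed.

Lemma ultralimit_PS_G
    (rho_surj : forall q : Spec_G (Rbar_grading MG), exists Q, rho MG Q = q)
    (F : set_system (PS_G MG)) :
  UltraFilter F -> exists Q, ultralimit basic_open F Q.
Proof.
move=> FU; pose q := [set a | F [set Q | p Q a]].
have iq : ideal q.
  split; rewrite /q /=.
  - by apply: filterS filterT => Q _; have [] := colon_Gr_ideal Q.
  - move=> a b Fa Fb; apply: filterS (filterI Fa Fb) => Q /= [].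
    by have [_ + _] := colon_Gr_ideal Q; apply.
  - move=> r a; apply: filterS => Q /=.
    by have [_ _] := colon_Gr_ideal Q; apply.
have Aq : Ann M `<=` q.
  by move=> a Aa; apply: filterS filterT => Q _; apply: Ann_colon.
have pq : graded_prime_ideal RG q.
  split.
  - apply/(graded_idealP _ iq) => a f qa df g; apply: filterS qa => Q pa.
    have [gp _ _] := PS_G_prime Q.
    exact: ((graded_idealP _ gp.1).1 gp a).
  - move=> e; have : q 1 by rewrite e.
    move/filter_ex => [Q p1]; have [[[_ _ pM] _] pT _] := PS_G_prime Q.
    by apply: pT; apply/seteqP; split=> // a _; rewrite -[a]mulr1; apply: pM.
  - move=> a b ha hb qab.
    (* If [a] is not in [p Q] for almost all [Q], the ultrafilter makes it lie outside almost all of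
       them, and primality of each [p Q] moves [b] in. *)
    have [qa|nqa] := in_ultra_setVsetC [set Q | p Q a] FU; first by left.
    right; apply: filterS (filterI qab nqa) => Q /= [pab npa].
    by have [_ _ /(_ a b ha hb pab) []] := PS_G_prime Q.
have [Q /(rho_eq _ _ iq Aq) e] := rho_surj (SpecG (Rbar_image_prime MG Aq pq)).
exists Q => a; rewrite /basic_open /= e; split=> [Fna Fa|nFa].
  by have [Q' []] := filter_ex (filterI Fna Fa).
by have [/nFa|] := in_ultra_setVsetC [set Q | p Q a] FU.
Qed.

End PrimarySpectrum.

(** * Separation in prime spectra, and the equivalences *)

Lemma Spec_T0 (A : comPzRingType) : T0_space (Spec A).
Proof.
move=> q q' qq'; apply: contra_not qq' => e.
suff cl (x y : Spec A) : closure [set x] y -> Spec_set x `<=` Spec_set y.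
  apply: Spec_eq; apply/seteqP; split; apply: cl.
    by rewrite e; apply: subset_closure.
  by rewrite -e; apply: subset_closure.
move=> xy a xa; apply: contrapT => ya.
have : nbhs y [set P : Spec A | ~ Spec_set P a].
  by apply: open_nbhs_nbhs; split=> //; apply: open_Spec_notin.
by move=> /xy [_ [-> ]].
Qed.

Lemma homeomorphic_T0 (X Y : topologicalType) :
  homeomorphic X Y -> T0_space Y -> T0_space X.
Proof.
move=> [f [g [fK gK cf cg]]] T0Y x y xy /seteqP [sxy syx].
have fxy : f x <> f y by move/(can_inj fK).
apply: T0Y fxy _.
have cl (u v : X) : closure [set v] u -> closure [set f v] (f u).
  by move=> uv U /cf /uv [_ [-> Ufv]]; exists (f v).
have cl' (u v : X) : closure [set u] `<=` closure [set v] ->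
    closure [set f u] `<=` closure [set f v].
  move=> uv z zu; rewrite -[z]gK; apply/cl/uv => U gU.
  have /zu [_ [-> Ufu]] : nbhs z (g @^-1` U) by apply: cg.
  by exists u; split=> //; rewrite -[u]fK.
by apply/seteqP; split; apply: cl'.
Qed.

Theorem theorem4p11 (G : groupType) (R : comPzRingType)
    (RG : ring_grading G R) (M : lmodType R) (MG : module_grading RG M)
    (SpecGM_nonempty : exists P : set M, graded_prime_submodule MG P)
    (PSGM_nonempty : inhabited (PS_G MG))
    (rho_surj : forall p : Spec_G (Rbar_grading MG), exists Q, rho MG Q = p) :
  [<-> T0_space (PS_G MG);
       forall Q Q' : PS_G MG, nu_G MG Q = nu_G MG Q' -> Q = Q';
       injective (rho MG);
       forall p : Spec_G RG, (PS_Gp MG p #<= `I_1)%card;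
       spectral_space (PS_G MG)].
Proof.
have rhoE (Q Q' : PS_G MG) : rho MG Q = rho MG Q' <->
    colon (Gr_M MG Q) = colon (Gr_M MG Q').
  apply: rho_eq; [exact: colon_Gr_ideal|exact: Ann_colon].
tfae.
- move=> T0 Q Q' /nu_G_inj/closure_PS_G_inj e; apply: contrapT => /T0; exact.
- by move=> H Q Q' /rhoE/nu_G_inj/H.
- move=> H q; apply/card_leI1P => Q Q' e e'; apply/H/rhoE.
  by rewrite e e'.
- move=> H; apply: (@hochster_spectral _ _ (@basic_open _ _ _ _ MG)).
  + exact: basic_open_open.
  + exact: basic_open_base.
  (* Separation of points is condition (4) at the graded prime attached to [Q], since the basic open
     sets determine that prime. *)
  + move=> Q Q' QQ'; have /card_leI1P := H (SpecG (PS_G_prime Q)); apply=> //=.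
    apply/seteqP; split=> a pa; apply: contrapT => npa;
      by [move/QQ': npa|case/QQ': npa].
  + exact: ultralimit_PS_G.
- by move=> [A /homeomorphic_T0]; apply; apply: Spec_T0.
Qed.
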